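(* Suppose that the mesh bound $|\mathcal O|\le\frac{m(\Omega)}{\alpha}h^{-\ell}$ holds and that the numerical fluxes are monotone, conservative, regular and consistent, as described in the context. Let $u_{\mathcal O,\delta t}$ be the approximate solution of problem $(P)$ defined by the implicit finite volume scheme described in the context. Let $T>0$ and set $N=\max\{n\in\mathbb N:\ n<T/\delta t\}$. Then there exists $C=C(\|f\|_{L^\infty},u_{\max},T)\ge0$ such that $$\frac12\sum_{n=0}^N\delta t\sum_{K\in\mathcal O}\sum_{L\in\mathcal N(K)}\tau_{K|L}\big|\phi(u_K^{n+1})-\phi(u_L^{n+1})\big|^2\le C.$$
   Context: Data. Let $\ell\ge1$, $\Omega\subset\mathbb R^\ell$ a bounded open set with Lipschitz boundary, $\eta$ the outward unit normal to $\partial\Omega$, $Q=(0,T)\times\Omega$, $u_{\max}>0$. The $\mathbb R^\ell$-valued function $f$ is continuous with $f(0)=f(u_{\max})=0$; $\|f\|_{L^\infty}$ is its sup norm on $[0,u_{\max}]$. The function $\phi$ is nondecreasing and Lipschitz continuous in $[0,u_{\max}]$, and for some $u_c\in[0,u_{\max}]$, $\phi\equiv0$ on $[0,u_c]$ and $\phi$ is strictly increasing on $[u_c,u_{\max}]$. The couple $(f,\phi)$ is non-degenerate: for every $\xi\in\mathbb R^\ell\setminus\{0\}$ the function $\lambda\mapsto\sum_i\xi_if_i(\lambda)$ is not affine on the non-degenerate subintervals of $[0,u_c]$. The initial datum $u_0$ takes values in $[0,u_{\max}]$. Problem $(P)$: $u_t+\operatorname{div}f(u)-\Delta\phi(u)=0$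 in $Q$, $u(0,\cdot)=u_0$ in $\Omega$, $(f(u)-\nabla\phi(u))\cdot\eta=0$ on $(0,T)\times\partial\Omega$. Mesh. $\mathcal O$ is a family of disjoint connected polygonal control volumes $K\subset\Omega$ whose closures have union $\overline\Omega$, the common interface of two control volumes being included in a hyperplane; $h=\sup_K\operatorname{diam}K$. There is $\alpha>0$ with $\alpha h^\ell\le m(K)$ and $m(\partial K)\le\frac1\alpha h^{\ell-1}$ for all $K$, which gives $|\mathcal O|\le\frac{m(\Omega)}{\alpha}h^{-\ell}$ for the number $|\mathcal O|$ of control volumes; $m$ denotes $\ell$- or $(\ell-1)$-dimensional measure. $\mathcal N(K)$ is the set of neighbours of $K$; $K|L$ is the common edge of $K$ and $L\in\mathcal N(K)$; $\bar\varepsilon_K$ is the set of all edges of $K$ (including those on $\partial\Omega$); $n_{K,\sigma}$ is the unit normal to $\sigma$ outward to $K$. The mesh is admissible: there are points $x_K\in K$ such that the line $x_Kx_L$ is orthogonal to $K|L$; $d_{K,L}=|x_K-x_L|$, $\tau_{K|L}=m(K|L)/d_{K,L}$. Numerical fluxes. For $K\in\mathcal O$, $\sigma\in\bar\varepsilon_K$, the flux $F_{K,\sigma}:\mathbb R^2\to\mathbb R$ (written $F_{K,L}$ if $\sigma=K|L$) satisfies, for arguments in $[0,u_{\max}]$: (monotone) $F_{K,\sigma}(a,b)$ is nondecreasing in $a$ and nonincreasing in $b$; (conservative) $F_{K,L}(a,b)=-F_{L,K}(b,a)$; (regular) $F_{K,\sigma}$ is Lipschitz continuous with Lipschitz constant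 $m(\sigma)M$; (consistent) $F_{K,\sigma}(s,s)=m(\sigma)f(s)\cdot n_{K,\sigma}$. Scheme. With time step $\delta t>0$: $u_K^0=\frac1{m(K)}\int_Ku_0\,dx$, and for all $n\ge0$, $K\in\mathcal O$, $$m(K)\frac{u_K^{n+1}-u_K^n}{\delta t}+\sum_{L\in\mathcal N(K)}F_{K,L}(u_K^{n+1},u_L^{n+1})-\sum_{L\in\mathcal N(K)}\tau_{K|L}\big(\phi(u_L^{n+1})-\phi(u_K^{n+1})\big)=0$$ (by convention the convective and diffusive fluxes of the scheme through boundary edges are zero). If the scheme has a solution, the function $u_{\mathcal O,\delta t}(t,x)=u_K^{n+1}$ for $x\in K$, $t\in(n\delta t,(n+1)\delta t]$ is called an approximate solution of $(P)$.
   Formalization: The time step is assumed to satisfy δt ≤ T (the bound fails with C independent of δt as δt → ∞), the discrete values u_K^n are taken in [0,u_max] where f, φ and the fluxes are given, and C may also depend on the fixed ℓ, Ω and φ. *)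

(* Defs.v *)
From HB Require Import structures.
From mathcomp Require Import all_boot all_order all_algebra.
From mathcomp Require Import all_classical all_reals all_analysis.

Set Implicit Arguments.
Unset Strict Implicit.
Unset Printing Implicit Defensive.

Import Order.TTheory GRing.Theory Num.Theory.
Import numFieldNormedType.Exports.

Local Open Scope classical_set_scope.
Local Open Scope ring_scope.


Definition rV_display : measure_display.
Proof. exact: default_measure_display. Qed.

Section rV_measurable.
Variables (R : realType) (n : nat).

Definition rV_coord (i : 'I_n) (x : 'rV[R]_n) : measurableTypeR R := x 0 i.

Definition rV_cylinders : set (set 'rV[R]_n) :=
  [set A | exists i, exists2 B, measurable B & A = rV_coord i @^-1` B].

(* the product sigma-algebra, which is the Borel sigma-algebra of R^n *)
HB.instance Definition _ := @isMeasurable.Build rV_display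
  'rV[R]_n <<s rV_cylinders >> (@sigma_algebra0 _ _ _) (@sigma_algebraC _ _)
  (@sigma_algebra_bigcup _ _ _).

Lemma measurable_rV_coord (i : 'I_n) : measurable_fun setT (rV_coord i).
Proof.
move=> _ Y mY; rewrite setTI; apply: sub_sigma_algebra.
by exists i, Y.
Qed.

Lemma measurable_fun_rV d (T : measurableType d) (f : T -> 'rV[R]_n) :
  (forall i, measurable_fun setT (rV_coord i \o f)) -> measurable_fun setT f.
Proof.
move=> mf; apply: (@measurability _ _ _ _ _ _ rV_cylinders) => //.
move=> _ [_ [i [B mB ->]] <-]; rewrite -comp_preimage.
exact: mf.
Qed.

End rV_measurable.

Section rV_cons.
Variables (R : realType) (n : nat).

Definition rV_cons (p : measurableTypeR R * 'rV[R]_n) : 'rV[R]_n.+1 :=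
  \row_i oapp (p.2 0) p.1 (unlift ord0 i).

Definition rV_uncons (x : 'rV[R]_n.+1) : measurableTypeR R * 'rV[R]_n :=
  (x 0 ord0, \row_i x 0 (lift ord0 i)).

Lemma rV_consK : cancel rV_cons rV_uncons.
Proof.
case=> a y; rewrite /rV_uncons mxE unlift_none/=; congr pair.
by apply/rowP => i; rewrite !mxE liftK.
Qed.

Lemma measurable_rV_cons : measurable_fun setT rV_cons.
Proof.
apply: measurable_fun_rV => i.
case: (unliftP ord0 i) => [j|] ->.
- rewrite (_ : _ \o _ = @rV_coord R n j \o snd); last first.
    by apply/funext => p; rewrite /= /rV_coord mxE liftK.
  by apply: measurableT_comp; [exact: measurable_rV_coord|exact: measurable_snd].
- rewrite (_ : _ \o _ = fst); first exact: measurable_fst.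
  by apply/funext => p; rewrite /= /rV_coord mxE unlift_none.
Qed.

Lemma measurable_rV_uncons : measurable_fun setT rV_uncons.
Proof.
apply: measurable_fun_pair; first exact: measurable_rV_coord.
apply: measurable_fun_rV => i.
rewrite (_ : _ \o _ = @rV_coord R n.+1 (lift ord0 i)).
  exact: measurable_rV_coord.
by apply/funext => x; rewrite /= /rV_coord mxE.
Qed.

Variable mu : {sigma_finite_measure set 'rV[R]_n -> \bar R}.

Definition rV_prod : set 'rV[R]_n.+1 -> \bar R :=
  pushforward (@lebesgue_measure R \x mu)%E rV_cons.

Let rV_prod0 : rV_prod set0 = 0%E.
Proof. by rewrite /rV_prod /pushforward preimage_set0 measure0. Qed.

Let rV_prod_ge0 A : (0 <= rV_prod A)%E.
Proof. by rewrite /rV_prod /pushforward; apply: measure_ge0. Qed.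

Let rV_prod_sigma_additive : semi_sigma_additive rV_prod.
Proof.
move=> F mF tF mUF; rewrite /rV_prod /pushforward preimage_bigcup.
apply: measure_semi_sigma_additive.
- by move=> k; rewrite -[X in measurable X]setTI; exact: measurable_rV_cons.
- apply/trivIsetP => /= i j _ _ ij; rewrite -preimage_setI.
  by move/trivIsetP : tF => /(_ _ _ _ _ ij) ->//; rewrite preimage_set0.
- by rewrite -preimage_bigcup -[X in measurable X]setTI; exact: measurable_rV_cons.
Qed.

HB.instance Definition _ := isMeasure.Build _ _ _
  rV_prod rV_prod0 rV_prod_ge0 rV_prod_sigma_additive.

Let rV_prod_sigma_finite : sigma_finite setT rV_prod.
Proof.
have /sigma_finiteP[F [TF ndF Foo]] := sigma_finiteT (@lebesgue_measure R).
have /sigma_finiteP[G [TG ndG Goo]] := sigma_finiteT mu.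
exists (fun k => rV_uncons @^-1` (F k `*` G k)).
  rewrite -preimage_bigcup [X in _ @^-1` X](_ : _ = setT) ?preimage_setT//.
  rewrite -subTset => -[x y] _.
  have [i _ Fx] : (\bigcup_i F i) x by rewrite -TF.
  have [j _ Gy] : (\bigcup_i G i) y by rewrite -TG.
  exists (maxn i j) => //; split => /=.
    by move: x Fx; exact/subsetPset/ndF/leq_maxl.
  by move: y Gy; exact/subsetPset/ndG/leq_maxr.
move=> k; have [mF Fk] := Foo k; have [mG Gk] := Goo k; split.
  rewrite -[X in measurable X]setTI; apply: measurable_rV_uncons => //.
  exact: measurableX.
rewrite /rV_prod /pushforward -comp_preimage.
rewrite (_ : _ \o _ = id); last by apply/funext => p; exact: rV_consK.
by rewrite preimage_id product_measure1E// lte_mul_pinfty// ge0_fin_numE.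
Qed.

HB.instance Definition _ := Measure_isSigmaFinite.Build _ _ _
  rV_prod rV_prod_sigma_finite.

End rV_cons.

Fixpoint lebesgue_rV (R : realType) (n : nat) :
    {sigma_finite_measure set 'rV[R]_n -> \bar R} :=
  if n is n'.+1 then rV_prod (lebesgue_rV R n') : {sigma_finite_measure set _ -> \bar _} else \d_(0 : 'rV[R]_0).


Section geometry.
Variables (R : realType) (l : nat).
Implicit Types (x y n e : 'rV[R]_l) (A K Omega : set 'rV[R]_l).

(* The library norm on 'rV[R]_l is the sup norm. *)
Definition dotv x y : R := \sum_i x 0 i * y 0 i.

Definition enorm x : R := Num.sqrt (dotv x x).

Definition vol A : R := fine (lebesgue_rV R l A).

(* (l-1)-dimensional measure of a subset A of a hyperplane with unit normal n:
   the volume of the right prism of height 1 with mid-section A. *)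
Definition flat_area n A : R :=
  vol [set x + t *: n | x in A & t in `[- 2^-1, 2^-1]].

Definition ediam A : R := sup [set enorm (x - y) | x in A & y in A].

Definition frontier A := closure A `\` A°.

(* Near each point of the frontier, Omega is the strict epigraph, in some
   direction e, of a Lipschitz function on the hyperplane orthogonal to e; such
   a function is encoded as a function on R^l which is invariant along e. *)
Definition lipschitz_boundary Omega := forall x0, frontier Omega x0 ->
  exists e (g : 'rV[R]_l -> R) (k r : R),
    [/\ dotv e e = 1, 0 < r,
        forall x t, g (x + t *: e) = g x,
        forall x y, `|g x - g y| <= k * enorm (x - y) &
        forall x, enorm (x - x0) < r -> (Omega x <-> g x < dotv e x)].

(* K is the interior of a bounded finite union of intersections of finitely
   many half-spaces [dotv h.1 x <= h.2], and has no slits. *)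
Definition polygonal K :=
  [/\ bounded_set K, K = (closure K)° &
      exists S : seq (seq ('rV[R]_l * R)),
        closure K = [set x | has (all (fun h => dotv h.1 x <= h.2)) S]].

End geometry.


Section data.
Variables (R : realType) (l : nat).
Implicit Types (umax uc : R) (f : R -> 'rV[R]_l) (phi : R -> R).

Record convection umax f : Prop := Convection {
  convection_continuous : {within `[0, umax], continuous f};
  convection_0 : f 0 = 0;
  convection_umax : f umax = 0 }.

Definition sup_norm umax f : R := sup [set enorm (f s) | s in `[0, umax]].

Record diffusion umax uc phi : Prop := Diffusion {
  diffusion_uc : 0 <= uc <= umax;
  diffusion_nondecreasing : {in `[0, umax] &, {homo phi : a b / a <= b}};
  diffusion_lipschitz : exists k, {in `[0, umax] &, forall a b,
    `|phi a - phi b| <= k * `|a - b|};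
  diffusion_zero : {in `[0, uc], forall a, phi a = 0};
  diffusion_increasing : {in `[uc, umax] &, {homo phi : a b / a < b}} }.

Definition non_degenerate uc f := forall xi : 'rV[R]_l, xi != 0 ->
  forall a b, 0 <= a -> a < b -> b <= uc ->
  ~ exists p q : R, {in `[a, b], forall s, dotv xi (f s) = p * s + q}.

End data.


(* Edges are represented by the closed sets of their points. [normal K s] is
   meaningful only for [s \in edges K]. *)
Record mesh (R : realType) (l : nat) (cell : finType) := Mesh {
  cv : cell -> set 'rV[R]_l;
  edges : cell -> seq (set 'rV[R]_l);
  normal : cell -> set 'rV[R]_l -> 'rV[R]_l;
  center : cell -> 'rV[R]_l }.

Section mesh_theory.
Variables (R : realType) (l : nat) (cell : finType) (M : mesh R l cell).
Implicit Types (K L : cell) (s : set 'rV[R]_l).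

Definition interface K L := closure (cv M K) `&` closure (cv M L).

(* L belongs to N(K) *)
Definition neighbour K L := (L != K) && (interface K L \in edges M K).

Definition edge_area K s : R := flat_area (normal M K s) s.

Definition perimeter K : R := \sum_(s <- edges M K) edge_area K s.

Definition center_dist K L : R := enorm (center M K - center M L).

Definition transmissivity K L : R :=
  edge_area K (interface K L) / center_dist K L.

Definition mesh_size : R := \big[Num.max/0]_(K : cell) ediam (cv M K).

Record admissible_mesh (Omega : set 'rV[R]_l) (alpha : R) : Prop :=
  AdmissibleMesh {
  cv_polygonal : forall K, polygonal (cv M K);
  cv_connected : forall K, connected (cv M K);
  cv_sub : forall K, cv M K `<=` Omega;
  cv_disjoint : forall K L, K != L -> cv M K `&` cv M L = set0;
  cv_cover : \bigcup_(K : cell) closure (cv M K) = closure Omega;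
  (* the edges of K are (l-1)-dimensional pieces of hyperplanes which make up
     the frontier of K, without overlap *)
  edges_uniq : forall K, uniq (edges M K);
  edges_closed : forall K s, s \in edges M K -> closed s;
  edges_area_gt0 : forall K s, s \in edges M K -> 0 < edge_area K s;
  edges_cover : forall K, frontier (cv M K) = \bigcup_(s in [set` edges M K]) s;
  edges_overlap : forall K s s', s \in edges M K -> s' \in edges M K ->
    s != s' -> flat_area (normal M K s) (s `&` s') = 0;
  normal_unit : forall K s, s \in edges M K ->
    dotv (normal M K s) (normal M K s) = 1;
  edges_flat : forall K s, s \in edges M K ->
    exists c, forall x, s x -> dotv (normal M K s) x = c;
  (* at points of s lying on no other edge, cv K is locally the open half-ball
     on one side of s *)
  normal_outward : forall K s x, s \in edges M K -> s x ->
    (forall s', s' \in edges M K -> s' x -> s' = s) ->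
    exists2 eps : R, 0 < eps & forall t, 0 < t < eps ->
      cv M K (x - t *: normal M K s) /\
      ~ closure (cv M K) (x + t *: normal M K s);
  edges_boundary_or_interface : forall K s, s \in edges M K ->
    s `<=` frontier Omega \/ exists2 L, L != K & s = interface K L;
  neighbour_sym : forall K L, neighbour K L -> neighbour L K;
  center_in : forall K, cv M K (center M K);
  center_orthogonal : forall K L, neighbour K L ->
    forall y z, interface K L y -> interface K L z ->
      dotv (center M K - center M L) (y - z) = 0;
  cv_regular : forall K, alpha * mesh_size ^+ l <= vol (cv M K);
  perimeter_regular : forall K, perimeter K <= alpha^-1 * mesh_size ^+ l.-1 }.


Definition fluxes := cell -> set 'rV[R]_l -> R -> R -> R.

Record numerical_flux (umax : R) (f : R -> 'rV[R]_l) (lip : R) (F : fluxes) :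
    Prop := NumericalFlux {
  flux_monotone_l : forall K s, s \in edges M K ->
    {in `[0, umax], forall b,
      {in `[0, umax] &, {homo (fun a => F K s a b) : a a' / a <= a'}}};
  flux_monotone_r : forall K s, s \in edges M K ->
    {in `[0, umax], forall a,
      {in `[0, umax] &, {homo F K s a : b b' / b <= b' >-> b' <= b}}};
  flux_conservative : forall K L, neighbour K L ->
    {in `[0, umax] &, forall a b,
      F K (interface K L) a b = - F L (interface L K) b a};
  flux_regular : forall K s, s \in edges M K ->
    {in `[0, umax] &, forall a b, {in `[0, umax] &, forall a' b',
      `|F K s a b - F K s a' b'| <=
        edge_area K s * lip * (`|a - a'| + `|b - b'|)}};
  flux_consistent : forall K s, s \in edges M K ->
    {in `[0, umax], forall a,
      F K s a a = edge_area K s * dotv (f a) (normal M K s)} }.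

(* The solution takes its values in [0, umax], the interval on which the data
   f, phi and the conditions on the numerical fluxes are given. *)
Record scheme_solution (umax dt : R) (phi : R -> R) (u0 : 'rV[R]_l -> R)
    (F : fluxes) (u : nat -> cell -> R) : Prop := SchemeSolution {
  scheme_range : forall n K, 0 <= u n K <= umax;
  scheme_init : forall K,
    u 0%N K = (vol (cv M K))^-1 * \int[lebesgue_rV R l]_(x in cv M K) u0 x;
  scheme_step : forall n K,
    vol (cv M K) * ((u n.+1 K - u n K) / dt)
    + \sum_(L | neighbour K L) F K (interface K L) (u n.+1 K) (u n.+1 L)
    - \sum_(L | neighbour K L)
        transmissivity K L * (phi (u n.+1 L) - phi (u n.+1 K)) = 0 }.

End mesh_theory.

(* Main.v *)
Require Import Defs.
From HB Require Import structures.
From mathcomp Require Import all_boot all_order all_algebra.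
From mathcomp Require Import all_classical all_reals all_analysis.
From mathcomp Require Import measurable_realfun.
From mathcomp Require Import ring lra.

Set Implicit Arguments.
Unset Strict Implicit.
Unset Printing Implicit Defensive.

Import Order.TTheory GRing.Theory Num.Theory.
Import numFieldNormedType.Exports.

Local Open Scope classical_set_scope.
Local Open Scope ring_scope.

(** Multiply the scheme by [phi (u n.+1 K)] and sum over the control volumes
    and the time steps ([energy_step]). By the symmetry of the
    transmissivities the diffusive terms add up to the sum to be estimated
    ([dissipationE]), so it suffices to bound the evolution terms and the
    convective terms from below.

    Both bounds are instances of one Abel summation, [abel_lower]: a sum
    [\sum_i c i * phi (u i)] is controlled as soon as all the partial sums of
    [c] over the superlevel sets of [u] are. For the evolution terms these
    partial sums collect the jumps landing above a level and telescope
    ([telescope_lower]). For the convective terms ([convection_lower]) let [A]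
    be the set of the cells where [u] is at least [w]. Conservativity cancels
    the fluxes inside [A]; across an interface leaving [A] the values are
    separated by [w], so that monotonicity and consistency replace the
    numerical flux by the flux of the constant state [w]. There remains the
    flux of a constant vector field out of the union of the cells of [A], counted
    on interior interfaces only.

    A constant field has zero total flux, so this remainder is minus the flux
    through the part of the boundary shared with [Omega], and it must be
    bounded by a constant that depends on [Omega] alone: this is
    [flux_through_union], the geometric core. Its proof compares the union [U]
    of the cells of [A] with its translate by a short vector [e *: v]. The part
    that leaves [U] and the part that enters it have the same volume
    ([exit_entry]). Up to [o(e)], the first one contains the disjoint prisms
    swept by the interfaces that leave [A] along [v] ([exit_volume_ge]), and the
    second one is covered by the prisms swept by those that enter [A] along [v],
    together with a layer along the frontier of [Omega] ([entry_volume_le]).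
    Dividing by [e] gives the flux inequality. If [Omega] has a mesh at all, its
    frontier is contained in the edges of one fixed mesh, whose total area
    bounds the layer for every other mesh ([frontier_layer]).

    This requires the volume of an oblique prism in terms of the area of its
    base, which is defined by a right prism ([vol_prism]), and a description
    of the cells on the two sides of an interface away from the other
    edges ([smooth_half_balls], [opposite_normals]). *)

(** * Lebesgue measure on R^l *)

Lemma lebesgue_measure_shift (R : realType) (a : R) (A : set (measurableTypeR R)) :
  measurable A ->
  lebesgue_measure ((fun x : measurableTypeR R => x + a : measurableTypeR R) @^-1` A)
  = lebesgue_measure A.
Proof.
move=> mA.
have mf : measurable_fun setT
    (fun x : measurableTypeR R => x + a : measurableTypeR R).
  by apply: measurable_funD => //; exact: measurable_cst.
apply/esym.
apply: (@lebesgue_measure_unique R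
   (pushforward lebesgue_measure (fun x : measurableTypeR R => x + a : measurableTypeR R))) => //.
move=> /= _ [[b c]] _ <-; rewrite /pushforward/=.
rewrite (_ : _ @^-1` _ = `]b - a, c - a]%classic); last first.
  by apply/seteqP; split => x /=; rewrite !in_itv/= ltrBlDr lerBrDr.
rewrite !lebesgue_measure_itv/= !lte_fin ltrD2r.
by case: ifP => // _; rewrite -!EFinB; congr EFin; ring.
Qed.

(** On measurable rectangles the translated measure is a product of translated
    measures, and a product measure is determined by its values there. *)
Lemma lebesgue_rV_shift (R : realType) (l : nat) (v : 'rV[R]_l)
    (A : set 'rV[R]_l) : measurable A ->
  lebesgue_rV R l ((fun x => x + v) @^-1` A) = lebesgue_rV R l A.
Proof.
elim: l v A => [|l IHl] v A mA.
  by congr (lebesgue_rV R 0 _); apply/seteqP; split => x /=; rewrite [x + v]thinmx0 [x]thinmx0.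
pose w : 'rV[R]_l := \row_i v 0 (lift ord0 i).
pose th (p : measurableTypeR R * 'rV[R]_l) : measurableTypeR R * 'rV[R]_l :=
  (p.1 + v 0 ord0, p.2 + w).
have mth : measurable_fun setT th.
  apply: measurable_fun_pair.
    by apply: measurable_funD; [exact: measurable_fst|exact: measurable_cst].
  apply: measurable_fun_rV => i.
  rewrite (_ : _ \o _ = (fun p : measurableTypeR R * 'rV[R]_l =>
    (rV_coord i p.2 : R) + w 0 i)); last first.
    by apply/funext => p /=; rewrite /rV_coord mxE.
  apply: measurable_funD; last exact: measurable_cst.
  by apply: measurableT_comp; [exact: measurable_rV_coord|exact: measurable_snd].
have mcons := @measurable_rV_cons R l.
have mcA : measurable ((@rV_cons R l) @^-1` A).
  by rewrite -[X in measurable X]setTI; exact: mcons.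
rewrite /= /rV_prod /pushforward.
rewrite [RHS](@product_measure_unique _ _ _ _ R (@lebesgue_measure R) (lebesgue_rV R l)
  (pushforward (@lebesgue_measure R \x lebesgue_rV R l)%E th)) //=.
- rewrite /pushforward; congr product_measure1; apply/seteqP; split => p /=;
    congr A; apply/rowP => i; rewrite !mxE /=;
    by case: (unliftP ord0 i) => [j|] ->; rewrite /= ?mxE.
- move=> B C mB mC; rewrite /pushforward.
  rewrite (_ : th @^-1` _ =
    (fun x : measurableTypeR R => x + v 0 ord0 : measurableTypeR R) @^-1` B
      `*` (fun x => x + w) @^-1` C) //.
  rewrite product_measure1E/=; first by rewrite lebesgue_measure_shift// IHl.
  + rewrite -[X in measurable X]setTI.
    have /(_ measurableT B mB) := measurable_funD
      (@measurable_id _ (measurableTypeR R) setT)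
      (@measurable_cst _ _ (measurableTypeR R) (measurableTypeR R) setT (v 0 ord0)).
    by [].
  + rewrite -[X in measurable X]setTI; apply: (measurable_fun_rV _) => // i.
    rewrite (_ : _ \o _ = (fun p : 'rV[R]_l => (rV_coord i p : R) + w 0 i)); last first.
      by apply/funext => p /=; rewrite /rV_coord mxE.
    apply: measurable_funD; last exact: measurable_cst.
    exact: measurable_rV_coord.
Qed.

Lemma archi_le0 (R : archiRealFieldType) (a b : R) :
  (forall k : nat, k%:R * a <= b) -> a <= 0.
Proof.
move=> h; rewrite leNgt; apply/negP => a0.
have b0 : 0 <= b by have := h 0%N; rewrite mul0r.
have := archi_boundP (divr_ge0 b0 (ltW a0)).
by rewrite ltr_pdivrMr// ltNge h.
Qed.

Lemma le_mu d (T : measurableType d) (R : realFieldType)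
    (mu : {measure set T -> \bar R}) (A B : set T) :
  measurable A -> measurable B -> A `<=` B -> (mu A <= mu B)%E.
Proof. by move=> mA mB AB; apply: le_measure; rewrite ?inE. Qed.

Section rV_basics.
Variables (R : realType) (l : nat).
Implicit Types (x y v n : 'rV[R]_l) (A B : set 'rV[R]_l).
Local Notation mu := (lebesgue_rV R l).

Lemma le_normrV x M : 0 <= M ->
  `|x| <= M <-> forall i, `|x 0 i| <= M.
Proof.
move=> M0; rewrite [`|x|]mx_normrE; split=> [|h].
  by move=> /bigmax_leP[_ h] i; apply: (h (0, i)).
by apply/bigmax_leP; split => // -[i j] _ /=; rewrite ord1.
Qed.

Lemma coord_le_norm x i : `|x 0 i| <= `|x|.
Proof. by apply: (le_normrV x (normr_ge0 x)).1. Qed.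

Lemma measurable_coord i : measurable_fun setT (fun x => x 0 i).
Proof. exact: measurable_rV_coord. Qed.

Lemma measurable_dotv n : measurable_fun setT (dotv n).
Proof.
apply: measurable_sum => i; apply: measurable_funM; first exact: measurable_cst.
exact: measurable_coord.
Qed.

Lemma measurable_affine (f : 'rV[R]_l -> R) v : measurable_fun setT f ->
  measurable_fun setT (fun x => x + f x *: v).
Proof.
move=> mf; apply: measurable_fun_rV => i.
rewrite (_ : _ \o _ = (fun x => x 0 i + f x * v 0 i)); last first.
  by apply/funext => x; rewrite /= /rV_coord !mxE.
apply: measurable_funD; first exact: measurable_coord.
by apply: measurable_funM => //; exact: measurable_cst.
Qed.

Lemma measurable_shift v : measurable_fun setT (fun x => x + v).
Proof.
rewrite (_ : (fun x => _) = (fun x => x + 1 *: v)).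
  by apply: measurable_affine; exact: measurable_cst.
by apply/funext => x; rewrite scale1r.
Qed.

Lemma measurable_shift_preimage v A :
  measurable A -> measurable ((fun x => x + v) @^-1` A).
Proof.
by move=> mA; rewrite -[X in measurable X]setTI; exact: measurable_shift.
Qed.

Definition cube (c : 'rV[R]_l) (r : R) : set 'rV[R]_l :=
  [set x | forall i, `|x 0 i - c 0 i| < r].

Lemma measurable_cube c r : measurable (cube c r).
Proof.
rewrite (_ : cube c r = \bigcap_(i in [set: 'I_l])
    ((fun x => x 0 i) @^-1` `]c 0 i - r, c 0 i + r[%classic)).
  apply: fin_bigcap_measurable => // i _; rewrite -[X in measurable X]setTI.
  exact: measurable_coord.
apply/seteqP; split => x /=.
  by move=> h i _ /=; rewrite in_itv/= -ltr_distl.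
by move=> h i; have := h i I; rewrite /= in_itv/= -ltr_distl.
Qed.

(** The product sigma-algebra contains the cubes, and an open set is the union
    of the countably many rational cubes that it contains. *)
Lemma open_measurable_rV A : open A -> measurable A.
Proof.
move=> oA.
pose D := ('rV[rat]_l * nat)%type.
pose box (d : D) := cube (map_mx ratr d.1) (d.2.+1%:R^-1).
pose F (d : D) := if pselect (box d `<=` A) then box d else set0.
rewrite (_ : A = \bigcup_(d : D) F d).
  apply: countable_bigcupT_measurable; first exact: countableP.
  move=> d; rewrite /F; case: pselect => [?|?]; last exact: measurable0.
  exact: measurable_cube.
apply/seteqP; split => [x Ax|x [d _]]; last first.
  by rewrite /F; case: pselect => //= + h; apply.
have /nbhs_ballP[e /= e0 xeA] : nbhs x A by exact: open_nbhs_nbhs.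
have [k ke] : exists k : nat, k.+1%:R^-1 < e / 2.
  have e2 : 0 < e / 2 by rewrite divr_gt0.
  by have [k ? h] := near_infty_natSinv_lt (PosNum e2); exists k; apply: (h k) => /=.
have qP i : exists q : rat, `|x 0 i - ratr q| < k.+1%:R^-1.
  have : x 0 i - k.+1%:R^-1 < x 0 i + k.+1%:R^-1.
    by rewrite ltrD2l gtrN// invr_gt0.
  move=> /rat_in_itvoo[q]; rewrite in_itv/= => qi; exists q.
  by rewrite distrC ltr_distl.
have [q qE] := choice qP.
exists (\row_i q i, k) => //; rewrite /F; case: pselect => [? i|]/=.
  by rewrite !mxE.
case=> y /= yq; apply: xeA; split => // i j; rewrite ord1 /ball/=.
have := yq j; have := qE j; rewrite !mxE => xq yqj.
rewrite -(subrKA (ratr (q j))) (le_lt_trans (ler_normD _ _))//.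
by rewrite (splitr e) ltrD// ?(lt_trans xq)// distrC (lt_trans yqj).
Qed.

Lemma closed_measurable_rV A : closed A -> measurable A.
Proof.
by move=> /closed_openC/open_measurable_rV mA; rewrite -(setCK A); exact: measurableC.
Qed.

Lemma bounded_setE A : bounded_set A <-> exists M, forall x, A x -> `|x| <= M.
Proof.
split=> [[M [_ h]]|[M h]].
  by exists (M + 1) => x Ax; apply: (h (M + 1)) => //; rewrite ltrDl.
by exists M; split; [exact: num_real|move=> ? ? x Ax; apply: le_trans (h _ Ax) _; exact: ltW].
Qed.

End rV_basics.

Lemma cube_fin (R : realType) l (M : R) : (lebesgue_rV R l (cube 0 M) < +oo)%E.
Proof.
elim: l => [|l IHl].
  by rewrite /= diracE; case: (_ \in _); rewrite ltry.
rewrite /= /rV_prod /pushforward.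
rewrite (_ : _ @^-1` _ = (`]- M, M[%classic : set (measurableTypeR R)) `*` @cube R l 0 M); last first.
  apply/seteqP; split => -[t y] /=.
    move=> h; split.
      have := h ord0; rewrite !mxE unlift_none /= subr0 in_itv/= ltr_norml.
      by [].
    move=> i; have := h (lift ord0 i); rewrite !mxE liftK/=.
    by [].
  rewrite in_itv/= => -[tM h] i; rewrite !mxE subr0.
  case: (unliftP ord0 i) => [j|] _ /=; last by rewrite ltr_norml.
  by have := h j; rewrite mxE subr0.
rewrite product_measure1E//=; last exact: measurable_cube.
rewrite lte_mul_pinfty//.
- by rewrite lebesgue_measure_itv/=; case: ifP.
Qed.

Section rV_null.
Variables (R : realType) (l : nat).
Implicit Types (x y v n : 'rV[R]_l) (A B : set 'rV[R]_l).
Local Notation mu := (lebesgue_rV R l).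

Lemma bounded_cube A : bounded_set A -> exists M, A `<=` cube 0 M.
Proof.
move=> /bounded_setE[M h]; exists (M + 1) => x /h xM i; rewrite mxE subr0.
by rewrite (le_lt_trans (le_trans (coord_le_norm x i) xM))// ltrDl.
Qed.

Lemma bounded_mu_fin A : measurable A -> bounded_set A -> (mu A < +oo)%E.
Proof.
move=> mA /bounded_cube[M AM]; apply: le_lt_trans (cube_fin l M).
exact: le_mu (measurable_cube _ _) AM.
Qed.

Lemma dotvC x y : dotv x y = dotv y x.
Proof. by apply: eq_bigr => i _; rewrite mulrC. Qed.

Lemma dotvDr x y n : dotv n (x + y) = dotv n x + dotv n y.
Proof. by rewrite -big_split; apply: eq_bigr => i _; rewrite mxE mulrDr. Qed.

Lemma dotvZr n (a : R) x : dotv n (a *: x) = a * dotv n x.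
Proof. by rewrite mulr_sumr; apply: eq_bigr => i _; rewrite mxE mulrCA. Qed.

Lemma dotvNr n x : dotv n (- x) = - dotv n x.
Proof. by rewrite -scaleN1r dotvZr mulN1r. Qed.

Lemma dotvBr x y n : dotv n (x - y) = dotv n x - dotv n y.
Proof. by rewrite dotvDr dotvNr. Qed.

Lemma dotvDl x y n : dotv (x + y) n = dotv x n + dotv y n.
Proof. by rewrite dotvC dotvDr !(dotvC n). Qed.

Lemma dotvZl n (a : R) x : dotv (a *: x) n = a * dotv x n.
Proof. by rewrite dotvC dotvZr (dotvC n). Qed.

Lemma dotvNl n x : dotv (- x) n = - dotv x n.
Proof. by rewrite dotvC dotvNr (dotvC n). Qed.

Lemma dotvBl x y n : dotv (x - y) n = dotv x n - dotv y n.
Proof. by rewrite dotvDl dotvNl. Qed.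

Lemma dotv_ge0 x : 0 <= dotv x x.
Proof. by apply: sumr_ge0 => i _; rewrite -expr2 sqr_ge0. Qed.

Lemma dotv_eq0 x : (dotv x x == 0) = (x == 0).
Proof.
apply/eqP/eqP => [|->]; last by rewrite -(scale0r 0) dotvZl mul0r.
move/psumr_eq0P => h; apply/rowP => i; rewrite mxE.
have /eqP := h (fun i _ => sqr_ge0 (x 0 i)) i isT.
by rewrite mulf_eq0 orbb => /eqP.
Qed.

Definition hplane n (c : R) : set 'rV[R]_l := [set x | dotv n x = c].

Lemma measurable_hplane n c : measurable (hplane n c).
Proof.
rewrite (_ : hplane n c = dotv n @^-1` [set c]) // -[X in measurable X]setTI.
by apply: measurable_dotv => //; exact: measurable_set1.
Qed.

(** Translates along the normal are disjoint, have equal volumes and stay in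
    a bounded set: arbitrarily many of them fit into a finite volume. *)
Lemma bounded_hplane_null n c A : n != 0 -> measurable A -> bounded_set A ->
  A `<=` hplane n c -> mu A = 0%E.
Proof.
move=> n0 mA bA An.
have mAfin : mu A \is a fin_num by rewrite ge0_fin_numE// bounded_mu_fin.
have [M AM] := (bounded_setE A).1 bA.
pose S (j : nat) := (fun x => x + j.+1%:R^-1 *: n) @^-1` A.
have mS j : measurable (S j) by exact: measurable_shift_preimage.
have tS : trivIset [set: nat] S.
  apply/trivIsetP => i j _ _ ij; apply/eqP/negPn/negP => /set0P[x [/An + /An]].
  rewrite /hplane /= !dotvDr !dotvZr => <- /addrI.
  have := n0; rewrite -dotv_eq0 => d0 /(mulIf d0) /invr_inj /eqP.
  by rewrite eqr_nat eqSS eq_sym (negbTE ij).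
have /= := measure_bigsetU mu mS tS.
pose B' := cube (0 : 'rV[R]_l) (M + `|n| + 1).
have Bfin : mu B' \is a fin_num by rewrite ge0_fin_numE// cube_fin.
move=> muS.
have muSE j : mu (S j) = mu A by exact: lebesgue_rV_shift.
have h k : k%:R * fine (mu A) <= fine (mu B').
  rewrite -lee_fin EFinM !fineK//.
  suff <- : mu (\big[setU/set0]_(i < k) S i) = (k%:R%:E * mu A)%E.
    apply: le_mu; [exact: bigsetU_measurable|exact: measurable_cube|].
    rewrite -bigcup_mkord => x [j _ /= /AM xM] i.
    rewrite mxE subr0 (le_lt_trans (coord_le_norm x i))//.
    rewrite (@le_lt_trans _ _ (M + `|n|)) ?ltrDl//.
    rewrite -[x](addrK (j.+1%:R^-1 *: n)) (le_trans (ler_normB _ _))// lerD//.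
    by rewrite normrZ ger0_norm// ler_piMl// invf_le1// ler1n.
  rewrite muS (eq_bigr (fun=> mu A)) => [|i _]; last exact: muSE.
  by rewrite -(fineK mAfin) sumEFin sumr_const card_ord -EFinM mulr_natl.
by rewrite -(fineK mAfin); congr EFin; apply/le_anti; rewrite fine_ge0 ?(archi_le0 h).
Qed.

Lemma hplane_null n c : n != 0 -> mu (hplane n c) = 0%E.
Proof.
move=> n0; apply: measure_negligible; first exact: measurable_hplane.
rewrite (_ : hplane n c = \bigcup_k (hplane n c `&` cube 0 k%:R)).
  apply: negligible_bigcup => k; apply/negligibleP.
    by apply: measurableI; [exact: measurable_hplane|exact: measurable_cube].
  apply: (bounded_hplane_null (c := c) n0).
  - by apply: measurableI; [exact: measurable_hplane|exact: measurable_cube].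
  - apply/bounded_setE; exists k%:R => x [_ h]; apply/le_normrV => // i.
    by have := h i; rewrite mxE subr0 => /ltW.
  - by move=> x [].
apply/seteqP; split => [x nx|x [k _ []]//].
exists (Num.bound (`|x|)) => //; split => // i; rewrite mxE subr0.
by rewrite (le_lt_trans (coord_le_norm x i))// archi_boundP.
Qed.

End rV_null.

(** * Prisms over flat sets *)

Lemma additive_ge0_linear (R : archiRealFieldType) (g : R -> R) :
  (forall s t, 0 <= s -> 0 <= t -> g (s + t) = g s + g t) ->
  (forall t, 0 <= t -> 0 <= g t) ->
  forall t, 0 <= t -> g t = t * g 1.
Proof.
move=> gD g0 t t0.
have g_le s u : 0 <= s -> s <= u -> g s <= g u.
  by move=> s0 su; rewrite -(subrK s u) gD ?subr_ge0// lerDr g0// subr_ge0.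
have gM k s : 0 <= s -> g (k%:R * s) = k%:R * g s.
  move=> s0; elim: k => [|k IHk].
    by have /eqP := gD 0 0 (lexx _) (lexx _); rewrite !mul0r addr0 addrC -subr_eq subrr => /eqP.
  by rewrite -natr1 !mulrDl gD ?mulr_ge0// ?mul1r// IHk.
apply/eqP; rewrite -subr_eq0 -normr_le0; apply: (@archi_le0 _ _ (g 1)) => k.
have kt0 : 0 <= k%:R * t by rewrite mulr_ge0.
have /andP[jk kj] := truncn_itv kt0; set j := Num.truncn _ in jk kj.
rewrite -[k%:R]ger0_norm// -normrM mulrBr -gM// mulrA.
have g1 : g (k%:R * t) <= (j%:R + 1) * g 1.
  rewrite natr1 -gM// mulr1 g_le// ltW//.
have g2 : j%:R * g 1 <= g (k%:R * t) by rewrite -gM// mulr1 g_le.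
have h1 : j%:R * g 1 <= k%:R * t * g 1 by rewrite ler_wpM2r// g0.
have h2 : k%:R * t * g 1 <= (j%:R + 1) * g 1.
  by rewrite ler_wpM2r ?g0// natr1 ltW.
by rewrite ler_norml; apply/andP; split; lra.
Qed.

Section prism.
Variables (R : realType) (l : nat).
Implicit Types (x y v w n : 'rV[R]_l) (A B : set 'rV[R]_l) (I : set R).
Local Notation mu := (lebesgue_rV R l).

Definition prism v A I : set 'rV[R]_l := [set x + t *: v | x in A & t in I].

Lemma prism_sub v A B I J : A `<=` B -> I `<=` J -> prism v A I `<=` prism v B J.
Proof. by move=> AB IJ _ [x Ax [t It <-]]; exists x; [exact: AB|exists t => //; exact: IJ]. Qed.

Lemma prism_hplane n c v A I : A `<=` hplane n c -> dotv n v = 0 ->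
  prism v A I `<=` hplane n c.
Proof.
move=> An nv _ [x /An xc [t _ <-]]; rewrite /hplane/= dotvDr dotvZr nv mulr0 addr0.
exact: xc.
Qed.

Lemma prismU v A I J : prism v A (I `|` J) = prism v A I `|` prism v A J.
Proof.
apply/seteqP; split => [_ [x Ax [t [It|Jt] <-]]|_ [] [x Ax [t It <-]]].
- by left; exists x => //; exists t.
- by right; exists x => //; exists t.
- by exists x => //; exists t => //; left.
- by exists x => //; exists t => //; right.
Qed.

Lemma prism_shift v A I (a : R) :
  prism v A [set t | I (t - a)] = (fun y => y + (- (a *: v))) @^-1` prism v A I.
Proof.
apply/seteqP; split => [_ [x Ax [t /= It <-]]|y [x Ax [t It /eqP]]].
  by exists x => //; exists (t - a) => //; rewrite scalerBl addrA.
rewrite eq_sym subr_eq => /eqP ->; exists x => //; exists (t + a) => /=.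
  by rewrite addrK.
by rewrite scalerDl addrA.
Qed.

Lemma bounded_prism v A I (M : R) : bounded_set A -> (forall t, I t -> `|t| <= M) ->
  bounded_set (prism v A I).
Proof.
move=> /bounded_setE[N AN] IM; apply/bounded_setE; exists (N + M * `|v|).
move=> _ [x Ax [t It <-]]; rewrite (le_trans (ler_normD _ _))// lerD ?AN//.
by rewrite normrZ ler_wpM2r// IM.
Qed.

Section flat.
Variables (n : 'rV[R]_l) (c : R) (v : 'rV[R]_l).
Hypothesis nv : dotv n v != 0.

(** Over a base in a hyperplane which [v] crosses, the height and the foot of a
    point of the prism are affine functions of the point; hence measurability, and
    compatibility with intersections of bases. *)
Lemma prismE A I : A `<=` hplane n c ->
  prism v A I = [set y | I ((dotv n y - c) / dotv n v) /\
    A (y + (- ((dotv n y - c) / dotv n v)) *: v)].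
Proof.
move=> An; apply/seteqP; split => [_ [x Ax [t It <-]]|y [Iy Ay]] /=.
  rewrite dotvDr dotvZr (An _ Ax) addrAC subrr add0r mulfK// scaleNr addrK.
  by split.
exists (y + (- ((dotv n y - c) / dotv n v)) *: v) => //.
by exists ((dotv n y - c) / dotv n v) => //; rewrite scaleNr subrK.
Qed.

Lemma measurable_prism A I : A `<=` hplane n c -> measurable A ->
  measurable (I : set (measurableTypeR R)) -> measurable (prism v A I).
Proof.
move=> An mA mI; rewrite prismE//.
pose q y : R := (dotv n y - c) / dotv n v.
have mq : measurable_fun setT q.
  apply: measurable_funM; last exact: measurable_cst.
  by apply: measurable_funB; [exact: measurable_dotv|exact: measurable_cst].
rewrite (_ : mkset _ = q @^-1` I `&` (fun y => y + (- q y) *: v) @^-1` A) //.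
apply: measurableI; rewrite -[X in measurable X]setTI; first exact: mq.
by apply: measurable_affine => //; exact: measurable_funN.
Qed.

Lemma prism_bigcap (A : nat -> set 'rV[R]_l) I : (forall k, A k `<=` hplane n c) ->
  \bigcap_k prism v (A k) I = prism v (\bigcap_k A k) I.
Proof.
move=> An; rewrite [RHS]prismE; last by move=> x /(_ 0%N Logic.I); exact: An.
apply/seteqP; split => [y h|y /= [Iy h] k _].
  by split => [|k _]; [have := h 0%N Logic.I|have := h k Logic.I]; rewrite prismE// => -[].
by rewrite prismE//; split => //; exact: h.
Qed.

Lemma prismI0 A I J : A `<=` hplane n c -> I `&` J = set0 ->
  prism v A I `&` prism v A J = set0.
Proof.
move=> An IJ; rewrite !prismE//; apply/seteqP; split => // y [[Iy _] [Jy _]].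
have : (I `&` J) ((dotv n y - c) / dotv n v) by [].
by rewrite IJ.
Qed.

Lemma mu_prism1 A t : A `<=` hplane n c -> measurable A -> mu (prism v A [set t]) = 0%E.
Proof.
move=> An mA; have n0 : n != 0.
  by apply: contra_neq nv => ->; rewrite -(scale0r 0) dotvZl mul0r.
apply: (subset_measure0 _ _ _ (hplane_null (c + t * dotv n v) n0)).
- exact: measurable_prism.
- exact: measurable_hplane.
- by move=> _ [x /An xc [_ -> <-]]; rewrite /hplane/= dotvDr dotvZr xc.
Qed.

Variable A : set 'rV[R]_l.
Hypotheses (An : A `<=` hplane n c) (mA : measurable A) (bA : bounded_set A).

Let g (t : R) := vol (prism v A `[0, t[).

Lemma fin_num_prism (b b' : bool) (s t : R) :
  mu (prism v A [set` Interval (BSide b s) (BSide b' t)]) \is a fin_num.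
Proof.
rewrite ge0_fin_numE// bounded_mu_fin//; first exact: measurable_prism.
apply: (@bounded_prism _ _ _ (`|s| + `|t|)) => // u.
rewrite /= => uI; have /andP[su ut] : s <= u <= t.
  by move: uI; rewrite in_itv => /andP[/lteifW -> /lteifW ->].
rewrite ler_norml; have := ler_norm s; have := ler_norm t.
by have := ler_norm (- s); have := ler_norm (- t); rewrite !normrN; lra.
Qed.

(** Stacking translates of a prism makes its volume additive in the height, and
    a nonnegative additive function is linear. *)
Lemma vol_prism_lin (t : R) : 0 <= t ->
  mu (prism v A `[0, t[) = (t * vol (prism v A `[0, 1[))%:E.
Proof.
move=> t0; rewrite -/(g 1) -(additive_ge0_linear (g := g))//.
- by rewrite /g /vol fineK// fin_num_prism.
- move=> a b a0 b0; apply: EFin_inj; rewrite EFinD /g /vol !fineK ?fin_num_prism//.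
  rewrite (_ : `[0, a + b[%classic = `[0, a[%classic `|` [set u | `[0, b[%classic (u - a)]); last first.
    apply/seteqP; split => u /=; rewrite !in_itv/=.
      move=> /andP[u0 uab]; case: (ltP u a) => ua; [left|right].
        by rewrite u0.
      by rewrite subr_ge0 ua ltrBlDr addrC.
    by case=> /andP[? ?]; apply/andP; split; lra.
  rewrite prismU measureU.
  + by rewrite (prism_shift v A `[0, b[%classic a) /=; congr (_ + _)%E;
      apply: lebesgue_rV_shift; exact: measurable_prism.
  + exact: measurable_prism.
  + rewrite (prism_shift v A `[0, b[%classic a); apply: measurable_shift_preimage; exact: measurable_prism.
  + apply: prismI0 => //; apply/seteqP; split => // u /= [].
    by rewrite !in_itv/= => /andP[? ?] /andP[? ?]; lra.
- by move=> s _; apply: fine_ge0.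
Qed.

(** The two faces are null, so they may be included or not. *)
Lemma mu_prism_itv (b b' : bool) (t : R) : 0 <= t ->
  mu (prism v A [set` Interval (BSide b 0) (BSide b' t)]) =
    (t * vol (prism v A `[0, 1[))%:E.
Proof.
move=> t0.
have mp (d d' : bool) (s u : R) : measurable (prism v A [set` Interval (BSide d s) (BSide d' u)]).
  exact: measurable_prism.
have m1 u : measurable (prism v A [set u]) by exact: measurable_prism.
pose P d d' := prism v A [set` Interval (BSide d 0) (BSide d' t)].
pose P0 := prism v A [set 0].
have H : (mu (P true false) <= mu (P false true))%E.
  have -> : mu (P false true) = (mu (P false true) + (mu P0 + mu (prism v A [set t])))%E.
    by rewrite !mu_prism1// !adde0.
  apply: (@le_trans _ _ (mu (P false true `|` (P0 `|` prism v A [set t])))).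
    apply: le_mu; [exact: mp|by apply: measurableU; [exact: mp|apply: measurableU; exact: m1]|].
    rewrite /P0 /P -!prismU; apply: prism_sub => // u /=; rewrite in_itv/=.
    move=> /andP[]; rewrite !le_eqVlt => /orP[/eqP<- _|u0]; first by right; left.
    by move=> /orP[/eqP ->|ut]; [right; right|left; rewrite in_itv/= u0].
  by apply: le_trans (measureU2 _ _ _) _; [exact: mp|apply: measurableU; exact: m1|
    apply: leeD2l; apply: measureU2; exact: m1].
have S (d d' : bool) : [set` Interval (BSide d 0) (BSide d' t)] `<=` `[0, t].
  by move=> u; rewrite /= !in_itv => /andP[/lteifW ? /lteifW ?]; apply/andP; split.
have S' (d d' : bool) : `]0, t[ `<=` [set` Interval (BSide d 0) (BSide d' t)].
  by move=> u; rewrite /= !in_itv/= => /andP[u0 ut]; rewrite !lteifS.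
have E (d d' : bool) : mu (P d d') = mu (P false true).
  apply/eqP; rewrite eq_le; apply/andP; split.
    by apply: le_trans H; apply: le_mu; [exact: mp|exact: mp|apply: prism_sub].
  by apply: le_mu; [exact: mp|exact: mp|apply: prism_sub].
by rewrite -/(P b b') E -(E true true) vol_prism_lin.
Qed.

End flat.

End prism.

(** * Volume of oblique prisms and area *)

Section fat.
Variables (R : realType) (l : nat).
Implicit Types (x y v w n : 'rV[R]_l) (A B : set 'rV[R]_l).
Local Notation mu := (lebesgue_rV R l).

Definition fat A (d : R) : set 'rV[R]_l := \bigcup_(z in A) ball z d.

Lemma fatP A d y : fat A d y <-> exists2 z, A z & `|z - y| < d.
Proof. by split=> -[z Az] h; exists z; rewrite // -?ball_normE// in h *; rewrite -ball_normE. Qed.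

Lemma sub_fat A d : 0 < d -> A `<=` fat A d.
Proof. by move=> d0 x Ax; apply/fatP; exists x => //; rewrite subrr normr0. Qed.

Lemma fat_le A d d' : d <= d' -> fat A d `<=` fat A d'.
Proof. by move=> dd y /fatP[z Az zy]; apply/fatP; exists z => //; exact: lt_le_trans dd. Qed.

Lemma measurable_fat A d : measurable (fat A d).
Proof.
have [d0|d0] := ltP 0 d.
  by apply: open_measurable_rV; apply: bigcup_open => z _; exact: ball_open.
rewrite (_ : fat A d = set0)//; apply/seteqP; split => // y /fatP[z _].
by move=> /(le_lt_trans (normr_ge0 _)); rewrite ltNge d0.
Qed.

Lemma bounded_fat A d : bounded_set A -> bounded_set (fat A d).
Proof.
move=> /bounded_setE[M AM]; apply/bounded_setE; exists (d + M) => y /fatP[z Az zy].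
rewrite -(subrK z y) (le_trans (ler_normD _ _))// lerD ?AN ?AM//.
by rewrite distrC ltW.
Qed.

(** The thickenings of a closed set decrease to it. *)
Lemma bigcap_fat A : closed A -> \bigcap_k fat A k.+1%:R^-1 = A.
Proof.
move=> cA; apply/seteqP; split => [y h|y Ay k _]; last exact: sub_fat.
apply: cA => U /nbhs_ballP[e /= e0 yeU].
have [k ? /(_ k (leqnn k))/= ke] := near_infty_natSinv_lt (PosNum e0).
have /fatP[z Az zy] := h k Logic.I.
exists z; split => //; apply: yeU; rewrite -ball_normE /=.
by rewrite distrC (lt_trans zy).
Qed.

Lemma bounded_subset A B : A `<=` B -> bounded_set B -> bounded_set A.
Proof. by move=> AB /bounded_setE[M BM]; apply/bounded_setE; exists M => x /AB/BM. Qed.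

(** Continuity of the volume from above: thickening [A] slightly adds little
    to the prism over [B `&` A]. *)
Lemma vol_prism_fat n c v A B : dotv n v != 0 -> B `<=` hplane n c ->
  measurable B -> bounded_set B -> closed A ->
  forall e, 0 < e -> exists2 d, 0 < d &
    vol (prism v (B `&` fat A d) `[0, 1[) <= vol (prism v (B `&` A) `[0, 1[) + e.
Proof.
move=> nv Bn mB bB cA e e0.
pose C k := B `&` fat A k.+1%:R^-1.
have mC k : measurable (C k) by apply: measurableI => //; exact: measurable_fat.
have Cn k : C k `<=` hplane n c by move=> x [/Bn].
have capC : \bigcap_k C k = B `&` A.
  rewrite -[in RHS](bigcap_fat cA); apply/seteqP; split => x h.
    by split; [exact: (h 0%N Logic.I).1|move=> k _; exact: (h k Logic.I).2].
  by move=> k _; split; [exact: h.1|exact: h.2].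
have BAn : B `&` A `<=` hplane n c by move=> x [/Bn].
have mBA : measurable (B `&` A) by apply: measurableI => //; exact: closed_measurable_rV.
have fC k : mu (prism v (C k) `[0, 1[) \is a fin_num.
  by apply: (fin_num_prism nv (Cn k)) => //; apply: bounded_subset bB => x [].
have fBA : mu (prism v (B `&` A) `[0, 1[) \is a fin_num.
  by apply: (fin_num_prism nv BAn) => //; apply: bounded_subset bB => x [].
have := @nonincreasing_cvg_mu _ _ _ mu (fun k => prism v (C k) `[0, 1[).
rewrite (prism_bigcap nv _ Cn) capC => /(_ _ _ _ _) h.
have {}h : mu \o (fun k => prism v (C k) `[0, 1[) @ \oo --> mu (prism v (B `&` A) `[0, 1[).
  apply: h.
  - by rewrite -ge0_fin_numE// fC.
  - by move=> k; exact: (measurable_prism nv (Cn k)).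
  - exact: (measurable_prism nv BAn).
  - move=> i j ij; apply/subsetPset; apply: prism_sub => // x [Bx Ax]; split => //.
    by apply: fat_le Ax; rewrite lef_pV2 ?posrE// ler_nat.
have {}h : (fun k => vol (prism v (C k) `[0, 1[)) @ \oo --> vol (prism v (B `&` A) `[0, 1[).
  by apply: (fine_cvg (f := mu \o (fun k => prism v (C k) `[0, 1[))); rewrite fineK.
have /cvgrPdist_le/(_ _ e0)[k _ /(_ k (leqnn k))/= hk] := h.
exists k.+1%:R^-1 => //; rewrite -/(C k).
by move: hk; rewrite distrC => /ler_normlW; rewrite lerBlDl.
Qed.

(** Prisms over the same base in two directions that have the same
    component along the normal. When they are thin, the horizontal offset
    between them is small, so the [v]-prism is contained in the [w]-prism over
    a slightly thicker base; by linearity in the height this compares the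
    prisms of height one, and the thickening is then removed by continuity. *)
Lemma vol_prism_le n c v w A : dotv n v != 0 -> dotv n v = dotv n w ->
  A `<=` hplane n c -> closed A -> bounded_set A ->
  vol (prism v A `[0, 1[) <= vol (prism w A `[0, 1[).
Proof.
move=> nv nvw An cA bA; have nw : dotv n w != 0 by rewrite -nvw.
have mA := closed_measurable_rV cA.
apply/ler_addgt0Pr => e e0.
pose B := hplane n c `&` fat A 1.
have Bn : B `<=` hplane n c by move=> x [].
have mB : measurable B by apply: measurableI; [exact: measurable_hplane|exact: measurable_fat].
have bB : bounded_set B by apply: (bounded_subset (B := fat A 1)); [move=> x []|exact: bounded_fat].
have [d d0 hd] := vol_prism_fat nw Bn mB bB cA e0.
have BA : B `&` A = A.
  by apply/setIidPr => x Ax; split; [exact: An|exact: sub_fat].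
rewrite BA in hd; apply: le_trans hd.
have r0 : 0 < `|v - w| + 1 by rewrite ltr_wpDl.
pose a := Num.min d 1 / (`|v - w| + 1).
have a0 : 0 < a by rewrite divr_gt0// lt_min d0 ltr01.
pose D := B `&` fat A d.
have Dn : D `<=` hplane n c by move=> x [/Bn].
have mD : measurable D by apply: measurableI => //; exact: measurable_fat.
have bD : bounded_set D by apply: bounded_subset bB => x [].
rewrite -(ler_pM2l a0) -lee_fin -(vol_prism_lin nv An)// ?(ltW a0)//.
rewrite -(vol_prism_lin nw Dn) ?(ltW a0)//.
apply: le_mu; [exact: (measurable_prism nv An)|exact: (measurable_prism nw Dn)|].
move=> _ [x Ax [t /= + <-]]; rewrite in_itv/= => /andP[t0 ta].
have xE : x + t *: v = (x + t *: (v - w)) + t *: w by rewrite scalerBr addrA subrK.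
rewrite xE; exists (x + t *: (v - w)); last by exists t => //=; rewrite in_itv/= t0.
have small : `|x - (x + t *: (v - w))| < Num.min d 1.
  rewrite opprD addNKr normrN normrZ ger0_norm//.
  rewrite -(@ltr_pM2r _ (`|v - w| + 1)^-1) ?invr_gt0// -/a; apply: le_lt_trans ta.
  by rewrite -mulrA ler_piMr// ler_pdivrMr// mul1r lerDl.
move: small; rewrite lt_min => /andP[xd x1].
split; last by apply/fatP; exists x.
split; last by apply/fatP; exists x.
by rewrite /hplane/= dotvDr dotvZr dotvBr nvw subrr mulr0 addr0; exact: An.
Qed.

Lemma flat_areaE n c A : dotv n n = 1 -> A `<=` hplane n c -> closed A ->
  bounded_set A -> flat_area n A = vol (prism n A `[0, 1[).
Proof.
move=> n1 An cA bA; have nn : dotv n n != 0 by rewrite n1 oner_neq0.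
have mA := closed_measurable_rV cA.
rewrite /flat_area /vol -/(prism n A `[- 2^-1, 2^-1]).
have -> : `[- 2^-1, 2^-1]%classic = [set t : R | `[0, 1]%classic (t - (- 2^-1))].
  apply/seteqP; split => t /=; rewrite !in_itv/= => /andP[? ?]; lra.
rewrite prism_shift lebesgue_rV_shift; last exact: (measurable_prism nn An).
by rewrite (mu_prism_itv nn An mA bA true false)// mul1r.
Qed.

Lemma flat_areaN n A : flat_area (- n) A = flat_area n A.
Proof.
congr vol; apply/seteqP; split => _ [x Ax [t /= It <-]]; exists x => //;
  exists (- t) => //=; rewrite ?scaleNr ?scalerN ?opprK//;
  by move: It; rewrite !in_itv/= => /andP[? ?]; lra.
Qed.

(** The prism along [v] is compared with the one along the normal component of
    [v], which is a rescaled right prism. *)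
Lemma vol_prism n c v A : dotv n n = 1 -> dotv n v != 0 -> A `<=` hplane n c -> closed A ->
  bounded_set A -> vol (prism v A `[0, 1[) = `|dotv n v| * flat_area n A.
Proof.
wlog nv0 : n c / 0 < dotv n v.
  move=> H n1 nv An cA bA; have := nv; rewrite neq_lt => /orP[nv0|nv0].
    rewrite -flat_areaN -normrN -dotvNl (H (- n) (- c))//.
    - by rewrite dotvNl oppr_gt0.
    - by rewrite dotvNl dotvNr opprK.
    - by rewrite dotvNl oppr_eq0.
    - by move=> x /An; rewrite /hplane/= dotvNl => ->.
  exact: (H n c).
move=> n1 nv An cA bA.
have nn : dotv n n != 0 by rewrite n1 oner_neq0.
have mA := closed_measurable_rV cA.
pose w := dotv n v *: n.
have nw : dotv n w = dotv n v by rewrite dotvZr n1 mulr1.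
have nw0 : dotv n w != 0 by rewrite nw.
have -> : vol (prism v A `[0, 1[) = vol (prism w A `[0, 1[).
  by apply/le_anti/andP; split; apply: (vol_prism_le (n := n) (c := c)).
have -> : prism w A `[0, 1[ = prism n A `[0, dotv n v[.
  apply/seteqP; split => _ [x Ax [t /= + <-]]; rewrite in_itv/= => /andP[t0 t1]; exists x => //.
    exists (t * dotv n v); rewrite ?scalerA//= in_itv/= mulr_ge0 ?(ltW nv0)//=.
    by rewrite gtr_pMl.
  exists (t / dotv n v) => /=.
    by rewrite in_itv/= divr_ge0 ?(ltW nv0)//= ltr_pdivrMr// mul1r.
  by rewrite /w scalerA divfK.
rewrite /vol (vol_prism_lin nn An)// ?(ltW nv0)//= gtr0_norm//.
by rewrite (flat_areaE n1 An).
Qed.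

Lemma mu_prism n c v A (b b' : bool) (t : R) : dotv n n = 1 -> dotv n v != 0 ->
  A `<=` hplane n c -> closed A -> bounded_set A -> 0 <= t ->
  mu (prism v A [set` Interval (BSide b 0) (BSide b' t)]) =
  (t * (`|dotv n v| * flat_area n A))%:E.
Proof.
move=> n1 nv An cA bA t0; rewrite (mu_prism_itv nv An)//; last exact: closed_measurable_rV.
by rewrite (vol_prism n1 nv An).
Qed.

(** A set contained in two non-parallel hyperplanes spans a prism that lies
    in a third hyperplane, so that its area vanishes. *)
Lemma flat_area_normal n n' c c' A : dotv n n = 1 -> dotv n' n' = 1 ->
  A `<=` hplane n c -> A `<=` hplane n' c' -> closed A -> bounded_set A ->
  flat_area n A = 0 \/ n' = n \/ n' = - n.
Proof.
move=> n1 n1' An An' cA bA.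
have nn : dotv n n != 0 by rewrite n1 oner_neq0.
have mA := closed_measurable_rV cA.
pose w := n' - dotv n n' *: n.
have nw : dotv w n = 0 by rewrite dotvBl dotvZl n1 mulr1 dotvC subrr.
have [w0|w0] := eqVneq w 0.
  right; have n'E : n' = dotv n n' *: n by apply/eqP; rewrite -subr_eq0 -/w w0.
  have /eqP : dotv n n' ^+ 2 = 1.
    by move: n1'; rewrite {1}n'E dotvZl -expr2.
  by rewrite sqrf_eq1 => /orP[] /eqP h; [left|right]; rewrite n'E h ?scale1r ?scaleN1r.
left; rewrite (flat_areaE n1 An)// /vol.
rewrite (_ : mu _ = 0%E)//; apply: (subset_measure0 _ _ _ (hplane_null (c' - dotv n n' * c) w0)).
- exact: (measurable_prism nn An).
- exact: measurable_hplane.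
- apply: prism_hplane => // x Ax.
  by rewrite /hplane/= dotvBl dotvZl (An _ Ax) (An' _ Ax).
Qed.

(** The area of an edge is computed with the normal of one of its two cells;
    this makes it independent of the choice. *)
Lemma flat_area_indep n n' c c' A : dotv n n = 1 -> dotv n' n' = 1 ->
  A `<=` hplane n c -> A `<=` hplane n' c' -> closed A -> bounded_set A ->
  flat_area n A = flat_area n' A.
Proof.
move=> n1 n1' An An' cA bA.
have [h|[->//|->]] := flat_area_normal n1 n1' An An' cA bA; last by rewrite flat_areaN.
have [h'|[<-//|->]] := flat_area_normal n1' n1 An' An cA bA; last by rewrite flat_areaN.
by rewrite h h'.
Qed.

End fat.

(** * Control volumes near an edge *)

Section line.
Variables (R : realType) (l : nat).
Implicit Types (x y v n : 'rV[R]_l) (K : set 'rV[R]_l).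

Lemma continuous_line x v : continuous (fun t : R => x + t *: v).
Proof.
by move=> t; apply: cvgD; [exact: cvg_cst|apply: cvgZr_tmp; exact: cvg_id].
Qed.

(** Connectedness: on a line interval that avoids the frontier of [K], the
    points of [K] are both open and closed. *)
Lemma line_frontier K x v (I : set R) : is_interval I -> open K ->
  (forall t, I t -> ~ frontier K (x + t *: v)) ->
  forall s t, I s -> I t -> K (x + s *: v) -> K (x + t *: v).
Proof.
move=> iI oK IK s t Is It Ks.
have cI : connected I by exact/connected_intervalP.
have := cI (I `&` (fun t => x + t *: v) @^-1` K).
move=> /(_ _ _ _)H; have {}H : I `&` (fun t => x + t *: v) @^-1` K = I.
  apply: H.
  - by exists s.
  - exists ((fun t => x + t *: v) @^-1` K) => //.
    by apply: open_comp => // u _; exact: continuous_line.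
  - exists ((fun t => x + t *: v) @^-1` closure K).
      by apply: closed_comp => [u _|]; [exact: continuous_line|exact: closed_closure].
    apply/seteqP; split => u /= [Iu Ku]; split => //.
      exact: subset_closure.
    apply/not_notP => nK; apply: (IK u Iu); split => //.
    by rewrite (interior_id _).1.
by have : I t by []; rewrite -H => -[].
Qed.

End line.

Section enorm.
Variables (R : realType) (l : nat).
Implicit Types (x y v n : 'rV[R]_l).

Lemma dotv_le_enorm n v : dotv n n = 1 -> `|dotv n v| <= enorm v.
Proof.
move=> n1; rewrite -sqrtr_sqr ler_wsqrtr//.
have := dotv_ge0 (v - dotv n v *: n).
rewrite dotvBl dotvZl !dotvBr !dotvZr n1 (dotvC v n) mulr1 subrr mulr0 subr0.
by rewrite subr_ge0 -expr2.
Qed.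

End enorm.

Section local_geometry.
Variables (R : realType) (l : nat) (cell : finType) (M : mesh R l cell).
Variables (Omega : set 'rV[R]_l) (alpha : R).
Hypothesis adm : admissible_mesh M Omega alpha.
Implicit Types (K L : cell) (s : set 'rV[R]_l) (x y z v : 'rV[R]_l).

Lemma cv_open K : open (cv M K).
Proof. by have [_ -> _] := cv_polygonal adm K; exact: open_interior. Qed.

Lemma cv_bounded K : bounded_set (cv M K).
Proof. by have [] := cv_polygonal adm K. Qed.

Lemma bounded_closure (A : set 'rV[R]_l) : bounded_set A -> bounded_set (closure A).
Proof.
move=> /bounded_setE[m Am]; apply/bounded_setE; exists (m + 1) => y Ay.
have [z [/Am Az]] := Ay _ (nbhsx_ballx y 1 ltr01); rewrite -ball_normE/= => yz.
rewrite -(subrK z y) addrC (le_trans (ler_normD _ _))// lerD//.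
exact: ltW.
Qed.

Lemma frontier_cvE K y : frontier (cv M K) y <-> exists2 s, s \in edges M K & s y.
Proof. by rewrite (edges_cover adm K); split=> -[s ? ?]; exists s. Qed.

Lemma edge_bounded K s : s \in edges M K -> bounded_set s.
Proof.
move=> sK; apply: bounded_subset (bounded_closure (cv_bounded K)) => y sy.
by have [] : frontier (cv M K) y by apply/frontier_cvE; exists s.
Qed.

Lemma edge_flat K s : s \in edges M K -> exists c, s `<=` hplane (normal M K s) c.
Proof. by move=> sK; have [c sc] := edges_flat adm sK; exists c. Qed.

(** Away from the corners, where several edges of [K] meet, [K] is locally a
    half-ball. *)
Definition smooth_point K s y :=
  s y /\ forall s', s' \in edges M K -> s' y -> s' = s.

(** The assumption on outward normals places only the points of the normal line
    through [y]. A small ball meets no other edge, and the segments from such a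
    point to the points of the same half of the ball do not cross the
    hyperplane of [s], hence avoid the frontier of [K]. *)
Lemma smooth_half_balls K s y : s \in edges M K -> smooth_point K s y ->
  exists2 r : R, 0 < r & forall z, `|y - z| < r ->
    (dotv (normal M K s) (z - y) < 0 -> cv M K z) /\
    (0 < dotv (normal M K s) (z - y) -> ~ closure (cv M K) z).
Proof.
move=> sK [sy sm]; set n := normal M K s.
have [c sn] := edge_flat sK; have yc : dotv n y = c by exact: sn.
have [r r0 hr] : exists2 r : R, 0 < r & forall z, `|y - z| < r ->
    frontier (cv M K) z -> s z.
  pose O : set 'rV[R]_l := \bigcup_(s' in [set` [seq s' <- edges M K | s' != s]]) s'.
  have cO : closed O.
    apply: closed_bigcup => [|s' /=]; first exact: finite_seq.
    by rewrite mem_filter => /andP[_]; exact: edges_closed adm _ _.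
  have : nbhs y (~` O).
    apply: open_nbhs_nbhs; split; first exact: closed_openC.
    move=> [s' /=]; rewrite mem_filter => /andP[s's s'K] s'y.
    by rewrite (sm _ s'K s'y) eqxx in s's.
  move=> /nbhs_ballP[r /= r0 rO]; exists r => // z zr /frontier_cvE[s' s'K s'z].
  have [<-//|s's] := eqVneq s' s.
  have [] := rO z; first by rewrite -ball_normE.
  by exists s' => //=; rewrite mem_filter s's.
have [eps eps0 heps] := normal_outward adm sK sy sm.
have n1 := normal_unit adm sK.
pose t := Num.min eps (r / (`|n| + 1)) / 2.
have nr : 0 < `|n| + 1 by rewrite ltr_wpDl.
have m0 : 0 < Num.min eps (r / (`|n| + 1)) by rewrite lt_min eps0 divr_gt0.
have t0 : 0 < t by rewrite divr_gt0.
have tm : t < Num.min eps (r / (`|n| + 1)) by rewrite ltr_pdivrMr// ltr_pMr// ltr1n.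
have [te tr] : t < eps /\ t * `|n| < r.
  move: tm; rewrite lt_min => /andP[-> h]; split => //.
  move: h; rewrite ltr_pdivlMr// => /(le_lt_trans _); apply.
  by rewrite ler_wpM2l ?(ltW t0)// lerDl.
have [Kmt Kpt] := heps t ltac:(by rewrite t0 te).
exists r => // z zr.
(* n . (q - y) keeps the sign of a for every q on the segment from y + a n to w *)
have seg (a : R) w : `|a| = t -> `|y - w| < r ->
   0 < a * dotv n (w - y) -> forall u, `[0, 1]%classic u ->
   ~ frontier (cv M K) ((y + a *: n) + u *: (w - (y + a *: n))).
  move=> at_ wr aw u; rewrite /= in_itv/= => /andP[u0 u1] fr.
  have := hr _ _ fr.
  have E : (y + a *: n) + u *: (w - (y + a *: n)) - y = (1 - u) *: (a *: n) + u *: (w - y).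
    by apply/rowP => i; rewrite !mxE; ring.
  have h1 : `|y - ((y + a *: n) + u *: (w - (y + a *: n)))| < r.
    rewrite distrC E (le_lt_trans (ler_normD _ _))// !normrZ.
    have u1' : 0 <= 1 - u by rewrite subr_ge0.
    rewrite (ger0_norm u0) (ger0_norm u1') at_ (distrC w).
    have [->|u_neq0] := eqVneq u 0; first by rewrite mul0r addr0 subr0 mul1r.
    have : u * `|y - w| < u * r by rewrite ltr_pM2l// lt_neqAle eq_sym u_neq0.
    have : (1 - u) * (t * `|n|) <= (1 - u) * r by rewrite ler_wpM2l ?subr_ge0// ltW.
    by lra.
  move=> /(_ h1)/sn; rewrite /hplane/= -yc => /eqP; rewrite -subr_eq0 -dotvBr E.
  rewrite dotvDr !dotvZr n1 mulr1 => /eqP e0.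
  have h : (1 - u) * a ^+ 2 + u * (a * dotv n (w - y)) = 0.
    by rewrite -[RHS](mulr0 a) -e0; ring.
  have a2 : 0 < a ^+ 2 by rewrite -(real_normK (num_real a)) at_ exprn_gt0.
  have : 0 <= (1 - u) * a ^+ 2 by rewrite mulr_ge0 ?subr_ge0// ltW.
  have : 0 <= u * (a * dotv n (w - y)) by rewrite mulr_ge0// ltW.
  have [u0'|u0'] := eqVneq u 0; first by move: h; rewrite u0' subr0 mul1r mul0r addr0; lra.
  have : 0 < u * (a * dotv n (w - y)) by rewrite mulr_gt0// lt_neqAle eq_sym u0'.
  by lra.
have i01 : is_interval (`[0 : R, 1]%classic) by exact: interval_is_interval.
have I0 : `[0 : R, 1]%classic 0 by rewrite /= in_itv/= lexx ler01.
have I1 : `[0 : R, 1]%classic 1 by rewrite /= in_itv/= lexx ler01.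
have E1 (a : R) : (y + a *: n) + 1 *: (z - (y + a *: n)) = z.
  by rewrite scale1r addrC subrK.
have E0 (a : R) : (y + a *: n) + 0 *: (z - (y + a *: n)) = y + a *: n.
  by rewrite scale0r addr0.
split => hz.
- have tN : `|- t| = t by rewrite normrN gtr0_norm.
  have tz : 0 < - t * dotv n (z - y) by rewrite mulNr -mulrN mulr_gt0// oppr_gt0.
  have := line_frontier i01 (cv_open (K := K)) (seg _ _ tN zr tz) I0 I1.
  by rewrite E0 E1 scaleNr; apply.
- move=> cKz; apply: Kpt; apply: subset_closure.
  have tN : `|t| = t by rewrite gtr0_norm.
  have tz : 0 < t * dotv n (z - y) by rewrite mulr_gt0.
  have Kz : cv M K z.
    apply/not_notP => nKz; have := seg _ _ tN zr tz 1 I1.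
    rewrite E1; apply; split => //.
    by rewrite (interior_id _).1//; exact: cv_open.
  have := line_frontier i01 (cv_open (K := K)) (seg _ _ tN zr tz) I1 I0.
  by rewrite E0 E1; apply.
Qed.

End local_geometry.

(** * Crossing an interface *)

Section crossing.
Variables (R : realType) (l : nat) (cell : finType) (M : mesh R l cell).
Variables (Omega : set 'rV[R]_l) (alpha : R).
Hypothesis adm : admissible_mesh M Omega alpha.
Implicit Types (K L : cell) (s : set 'rV[R]_l) (x y z v : 'rV[R]_l).

Lemma exists_small (t r a : R) : 0 < t -> 0 < r -> 0 <= a ->
  exists2 d, 0 < d < t & d * a < r.
Proof.
move=> t0 r0 a0; have a1 : 0 < a + 1 by rewrite ltr_wpDl.
have ra : 0 < r / (a + 1) by rewrite divr_gt0.
have [tr|rt] := leP t (r / (a + 1)).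
  exists (t / 2).
    by rewrite divr_gt0//= ltr_pdivrMr// ltr_pMr// ltr1n.
  have : t * (a + 1) <= r by rewrite -ler_pdivlMr.
  have : 0 <= t * a by rewrite mulr_ge0// ltW.
  by lra.
exists (r / (a + 1) / 2).
  by rewrite divr_gt0//= (le_lt_trans _ rt)// ler_pdivrMr// ler_peMr// ?ler1n// ltW.
have : r / (a + 1) * (a + 1) = r by rewrite divfK// gt_eqF.
have : 0 <= r / (a + 1) * a by rewrite mulr_ge0// ltW.
by lra.
Qed.

(** The half-ball at [y] decides on which side of the frontier the line starts, and
    avoiding the frontier propagates this to the point [y - t *: v]. *)
Lemma near_side K s y v (t : R) : s \in edges M K -> smooth_point M K s y ->
  0 < t -> (forall u, 0 < u <= t -> ~ frontier (cv M K) (y - u *: v)) ->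
  (0 < dotv (normal M K s) v -> cv M K (y - t *: v)) /\
  (dotv (normal M K s) v < 0 -> ~ cv M K (y - t *: v)).
Proof.
move=> sK sm t0 avoid.
have [r r0 hr] := smooth_half_balls adm sK sm.
have [d /andP[d0 dt] dv] := exists_small t0 r0 (normr_ge0 v).
have [hK hNK] : (0 < dotv (normal M K s) v -> cv M K (y - d *: v)) /\
  (dotv (normal M K s) v < 0 -> ~ cv M K (y - d *: v)).
  have [|hm hp] := hr (y - d *: v); first by rewrite opprB addrCA subrr addr0 normrZ gtr0_norm.
  rewrite addrAC subrr add0r dotvNr dotvZr in hm hp; split => nv.
    by apply: hm; rewrite oppr_lt0 mulr_gt0.
  by move=> /subset_closure; apply: hp; rewrite oppr_gt0 nmulr_llt0.
have iI : is_interval `]0, t]%classic by exact: interval_is_interval.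
have It : `]0, t]%classic t by rewrite /= in_itv/= t0 lexx.
have Id : `]0, t]%classic d by rewrite /= in_itv/= d0 ltW.
have av u : `]0, t]%classic u -> ~ frontier (cv M K) (y + u *: (- v)).
  by rewrite /= in_itv/= scalerN => /avoid.
have line := line_frontier iI (cv_open adm (K := K)) av.
split => [/hK Kd|/hNK nKd Kt].
  by have := line _ _ Id It; rewrite !scalerN; apply.
by apply: nKd; have := line _ _ It Id; rewrite !scalerN; apply.
Qed.

Lemma interfaceC K L : interface M K L = interface M L K.
Proof. exact: setIC. Qed.

Lemma neighbour_edge K L : neighbour M K L -> interface M K L \in edges M K.
Proof. by case/andP. Qed.

Lemma neighbour_edge_sym K L : neighbour M K L -> interface M K L \in edges M L.
Proof. by move=> /(neighbour_sym adm)/neighbour_edge; rewrite interfaceC. Qed.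

(** Two half-balls centred at the same point are disjoint only if they are opposite:
    otherwise both contain the points near [y] in the direction opposite to
    the sum of the normals. *)
Lemma opposite_normals K L s y : K != L -> s \in edges M K -> s \in edges M L ->
  smooth_point M K s y -> smooth_point M L s y -> normal M L s = - normal M K s.
Proof.
move=> KL sK sL smK smL.
have [r r0 hr] := smooth_half_balls adm sK smK.
have [r' r'0 hr'] := smooth_half_balls adm sL smL.
set n := normal M K s; set n' := normal M L s.
have n1 : dotv n n = 1 := normal_unit adm sK.
have n1' : dotv n' n' = 1 := normal_unit adm sL.
have rr : 0 < Num.min r r' by rewrite lt_min r0.
have [d /andP[d0 _] dn] := exists_small ltr01 rr (normr_ge0 (n + n')).
pose z := y - d *: (n + n').
have zy : z - y = - d *: (n + n') by rewrite /z addrAC subrr add0r scaleNr.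
have : `|y - z| < Num.min r r'.
  by rewrite distrC zy normrZ normrN gtr0_norm.
rewrite lt_min => /andP[/hr[Kz _] /hr'[Lz _]].
have [h|h] := ltP 0 (1 + dotv n n').
  have : (cv M K `&` cv M L) z.
    split; [apply: Kz|apply: Lz]; rewrite zy dotvZr mulNr oppr_lt0 dotvDr mulr_gt0//.
      by rewrite -/n n1.
    by rewrite -/n' n1' dotvC addrC.
  by rewrite (cv_disjoint adm KL).
apply/eqP; rewrite -subr_eq0 opprK addrC -dotv_eq0 eq_le dotv_ge0 andbT.
by rewrite dotvDl !dotvDr -/n -/n' n1 n1' (dotvC n' n); lra.
Qed.

Definition hits (e : R) v x s := exists2 t, 0 <= t <= e & s (x + t *: v).

(** A short segment that meets two edges of [K] passes near a corner, and what it
    crosses is not decided by a half-ball. *)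
Definition corner K e v : set 'rV[R]_l := [set x | exists s s',
  [/\ s \in edges M K, s' \in edges M K, s != s', hits e v x s & hits e v x s']].

(** Segments that meet an edge parallel to them are included, since they start in
    its hyperplane. *)
Definition grazing e v : set 'rV[R]_l := [set x | exists K s y,
  [/\ s \in edges M K, s y & dotv (normal M K s) x = dotv (normal M K s) y \/
     dotv (normal M K s) (x + e *: v) = dotv (normal M K s) y]].

Lemma hits_smooth K s e v x t : s \in edges M K -> ~ corner K e v x ->
  0 <= t <= e -> s (x + t *: v) ->
  smooth_point M K s (x + t *: v) /\
  (dotv (normal M K s) v != 0 -> forall u, 0 <= u <= e -> u != t ->
     ~ frontier (cv M K) (x + u *: v)).
Proof.
move=> sK nc te sx.
have H s' u : s' \in edges M K -> 0 <= u <= e -> s' (x + u *: v) -> s' = s.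
  move=> s'K ue s'u; apply/eqP/negPn/negP => s's; apply: nc.
  by exists s', s; split => //; [exists u|exists t].
split; first by split => // s' s'K; exact: H.
move=> nv u ue ut /(frontier_cvE adm)[s' s'K s'u].
have E := H _ _ s'K ue s'u; rewrite {}E in s'u.
have [c sc] := edge_flat adm sK.
have /eqP := sc _ s'u; rewrite -(sc _ sx) !dotvDr !dotvZr (inj_eq (addrI _)).
by rewrite (inj_eq (mulIf nv)) (negbTE ut).
Qed.

(** Apart from corners, a segment that crosses an interface in the direction of
    the outward normal meets no other edge of the two cells, so it runs in
    the first one and then in the second one. *)
Lemma cross_interface K L e v x t : neighbour M K L -> 0 < t < e ->
  interface M K L (x + t *: v) -> 0 < dotv (normal M K (interface M K L)) v ->
  ~ corner K e v x -> ~ corner L e v x -> cv M K x /\ cv M L (x + e *: v).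
Proof.
move=> KL /andP[t0 te] sx nv ncK ncL; set s := interface M K L in sx nv.
have sK : s \in edges M K := neighbour_edge KL.
have sL : s \in edges M L := neighbour_edge_sym KL.
have tI : 0 <= t <= e by rewrite !ltW.
have [smK avK] := hits_smooth sK ncK tI sx.
have [smL avL] := hits_smooth sL ncL tI sx.
have LK : K != L by case/andP: KL; rewrite eq_sym.
have nLE := opposite_normals LK sK sL smK smL.
have nv0 : dotv (normal M K s) v != 0 by rewrite gt_eqF.
have nv0' : dotv (normal M L s) v != 0 by rewrite nLE dotvNl oppr_eq0.
split.
- have [|h _] := near_side sK smK (t := t) (v := v) t0.
    move=> u /andP[u0 ut]; rewrite -addrA -scalerBl; apply: avK => //.
      by rewrite subr_ge0 ut/= lerBlDr (le_trans (ltW te))// lerDl ltW.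
    by rewrite lt_eqF// gtrBl.
  by have := h nv; rewrite addrK.
- have et : 0 < e - t by rewrite subr_gt0.
  have [|h _] := near_side sL smL (t := e - t) (v := - v) et.
    move=> u /andP[u0 ut]; rewrite scalerN opprK -addrA -scalerDl; apply: avL => //.
      by rewrite addr_ge0 ?(ltW t0) ?(ltW u0)//=; lra.
    by rewrite gt_eqF// ltrDl.
  have := h; rewrite nLE dotvNl dotvNr opprK => /(_ nv).
  by rewrite scalerN opprK -addrA -scalerDl (addrC t) subrK.
Qed.

(** A segment that ends in the union of the cells of [A] and starts outside of it must
    cross an edge of its final cell [K]; this edge is not on the frontier of
    [Omega], and the cell on its other side contains the starting point, hence is not
    in [A]. *)
Lemma enter_union (A : {set cell}) e v x K : 0 < e -> K \in A ->
  (forall J, J \in A -> ~ cv M J x) -> cv M K (x + e *: v) ->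
  ~ hits e v x (frontier Omega) -> ~ grazing e v x -> (forall J, ~ corner J e v x) ->
  exists L, [/\ L \notin A, neighbour M K L,
    0 < dotv (normal M L (interface M L K)) v & hits e v x (interface M L K)].
Proof.
move=> e0 KA xA Kxe nO ng nc.
have [t te [s sK sx]] : exists2 t, 0 <= t <= e &
    exists2 s, s \in edges M K & s (x + t *: v).
  apply/not_notP => h; apply: (xA K KA).
  have iI : is_interval `[0, e]%classic by exact: interval_is_interval.
  have I0 : `[0, e]%classic 0 by rewrite /= in_itv/= lexx ltW.
  have Ie : `[0, e]%classic e by rewrite /= in_itv/= lexx ltW.
  have := line_frontier iI (cv_open adm (K := K)) _ Ie I0 Kxe.
  rewrite scale0r addr0; apply => u; rewrite /= in_itv/= => ue /(frontier_cvE adm)[s sK sx].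
  by apply: h; exists u => //; exists s.
have := edges_boundary_or_interface adm sK => -[sO|[L LK sE]].
  by exfalso; apply: nO; exists t => //; exact: sO.
have KL : neighbour M K L by rewrite /neighbour LK -sE.
have LKn := neighbour_sym adm KL.
have sEL : s = interface M L K by rewrite sE interfaceC.
have [smK avK] := hits_smooth sK (nc K) te sx.
have sL : s \in edges M L by rewrite sE; exact: neighbour_edge_sym.
have [smL avL] := hits_smooth sL (nc L) te sx.
have KneL : K != L by rewrite eq_sym.
have nLE := opposite_normals KneL sK sL smK smL.
have nv0 : dotv (normal M K s) v != 0.
  apply/eqP => nv; apply: ng; exists K, s, (x + t *: v); split => //; left.
  by rewrite dotvDr dotvZr nv mulr0 addr0.
have t0 : 0 < t.
  have /andP[t0 _] := te; rewrite lt_neqAle t0 andbT; apply/eqP => tE.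
  by apply: ng; exists K, s, (x + t *: v); split => //; left; rewrite -tE scale0r addr0.
have te' : t < e.
  have /andP[_ te'] := te; rewrite lt_neqAle te' andbT; apply/eqP => tE.
  by apply: ng; exists K, s, (x + t *: v); split => //; right; rewrite tE.
have nv : dotv (normal M K s) v < 0.
  rewrite ltNge; apply/negP; rewrite le_eqVlt eq_sym (negbTE nv0)/= => nv.
  have et : 0 < e - t by rewrite subr_gt0.
  have [|_ h] := near_side sK smK (t := e - t) (v := - v) et.
    move=> u /andP[u0 ut]; rewrite scalerN opprK -addrA -scalerDl; apply: avK => //.
      by rewrite addr_ge0 ?(ltW t0) ?(ltW u0)//=; lra.
    by rewrite gt_eqF// ltrDl.
  have := h; rewrite dotvNr oppr_lt0 => /(_ nv); apply.
  by rewrite scalerN opprK -addrA -scalerDl (addrC t) subrK.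
have nLv : 0 < dotv (normal M L s) v by rewrite nLE dotvNl oppr_gt0.
exists L; rewrite -sEL; split => //; last by exists t.
apply/negP => LA; apply: (xA L LA).
have t0e : 0 < t < e by rewrite t0.
rewrite sEL in nLv sx.
by have [] := cross_interface LKn t0e sx nLv (nc L) (nc K).
Qed.

End crossing.

Lemma closed_setI (T : topologicalType) (A B : set T) :
  closed A -> closed B -> closed (A `&` B).
Proof.
move=> cA cB; rewrite -(setCK (_ `&` _)) setCI; apply: open_closedC.
by apply: openU; exact: closed_openC.
Qed.

(** * Volume estimates by covering *)

Section covered.
Variables (R : realType) (l : nat).
Implicit Types (S P : set 'rV[R]_l).
Local Notation mu := (lebesgue_rV R l).

(** A bound on the outer volume: it spares measurability proofs for
    sets of starting points defined by incidence conditions. *)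
Definition covered S (r : R) :=
  exists P, [/\ measurable P, S `<=` P & (mu P <= r%:E)%E].

Lemma covered_le S S' r r' : S `<=` S' -> r <= r' -> covered S' r -> covered S r'.
Proof.
move=> SS rr [P [mP SP Pr]]; exists P; split => //; first exact: subset_trans SP.
by rewrite (le_trans Pr)// lee_fin.
Qed.

Lemma covered_mu S r : measurable S -> covered S r -> (mu S <= r%:E)%E.
Proof. by move=> mS [P [mP SP]]; apply: le_trans; exact: le_mu. Qed.

Lemma covered0 : covered set0 0.
Proof. by exists set0; split => //; rewrite measure0. Qed.

Lemma coveredU S S' r r' : covered S r -> covered S' r' -> covered (S `|` S') (r + r').
Proof.
move=> [P [mP SP Pr]] [P' [mP' SP' Pr']]; exists (P `|` P'); split.
- exact: measurableU.
- exact: setUSS.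
- by apply: le_trans (measureU2 _ _ _) _ => //; rewrite EFinD leeD.
Qed.

Lemma covered_seq (I : eqType) (s : seq I) (S : I -> set 'rV[R]_l) (r : I -> R) :
  (forall i, i \in s -> covered (S i) (r i)) ->
  covered (\bigcup_(i in [set` s]) S i) (\sum_(i <- s) r i).
Proof.
elim: s => [|i s IHs] h.
  by rewrite big_nil; apply: covered_le covered0 => // x [].
rewrite big_cons; apply: covered_le (coveredU (h i _) (IHs _)) => //.
- move=> x [j /=]; rewrite inE => /predU1P[->|js] xj; first by left.
  by right; exists j.
- by rewrite mem_head.
- by move=> j js; apply: h; rewrite inE js orbT.
Qed.

Lemma covered_hplane n c : n != 0 -> covered (hplane n c) 0.
Proof.
by move=> n0; exists (hplane n c); split => //;
  [exact: measurable_hplane|rewrite hplane_null].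
Qed.

Lemma disjoint_sum_le (I : eqType) (s : seq I) (Q : I -> set 'rV[R]_l) X :
  uniq s -> measurable X -> (forall i, i \in s -> measurable (Q i)) ->
  (forall i, i \in s -> Q i `<=` X) ->
  (forall i j, i \in s -> j \in s -> i != j -> Q i `&` Q j = set0) ->
  (\sum_(i <- s) mu (Q i) <= mu X)%E.
Proof.
elim: s X => [|i s IHs] X /=; first by rewrite big_nil.
move=> /andP[i_s us] mX mQ QX Q0; rewrite big_cons.
have is_ : i \in i :: s by exact: mem_head.
have ss j : j \in s -> j \in i :: s by move=> js; rewrite inE js orbT.
have -> : X = Q i `|` (X `\` Q i) by rewrite setDE setUIr setUv setIT setUidr//; exact: QX.
rewrite measureU; [|exact: mQ|by apply: measurableD => //; exact: mQ|by rewrite setDIK].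
apply: leeD => //; apply: IHs => //.
- by apply: measurableD => //; exact: mQ.
- by move=> j /ss; exact: mQ.
- move=> j js x Qx; split; first exact: QX (ss _ js) _ Qx.
  move=> Qix; have ij : i != j by apply: contraNneq i_s => ->.
  by have : (Q i `&` Q j) x by []; rewrite Q0// ss.
- by move=> j k /ss js /ss ks; exact: Q0.
Qed.

(** The outer volume of [S e] is [o(e)] as [e] tends to 0. *)
Definition small (S : R -> set 'rV[R]_l) := forall eta, 0 < eta ->
  exists2 e0, 0 < e0 & forall e, 0 < e < e0 -> covered (S e) (e * eta).

Lemma small_sub (S S' : R -> set 'rV[R]_l) : (forall e, S e `<=` S' e) -> small S' -> small S.
Proof.
move=> SS sS eta /sS[e0 e00 h]; exists e0 => // e /h; exact: covered_le (SS e) (lexx _).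
Qed.

Lemma small_null (S : R -> set 'rV[R]_l) : (forall e, covered (S e) 0) -> small S.
Proof.
move=> h eta eta0; exists 1 => // e /andP[e0 _]; apply: covered_le (h e) => //.
by rewrite mulr_ge0// ltW.
Qed.

Lemma smallU (S S' : R -> set 'rV[R]_l) : small S -> small S' -> small (fun e => S e `|` S' e).
Proof.
move=> sS sS' eta eta0; have eta2 : 0 < eta / 2 by rewrite divr_gt0.
have [a a0 ha] := sS _ eta2; have [b b0 hb] := sS' _ eta2.
exists (Num.min a b) => [|e]; first by rewrite lt_min a0.
rewrite lt_min => /and3P[e0 ea eb].
have -> : e * eta = e * (eta / 2) + e * (eta / 2) by rewrite -mulrDr -splitr.
by apply: coveredU; [apply: ha|apply: hb]; rewrite e0.
Qed.

Lemma small_seq (I : eqType) (s : seq I) (S : I -> R -> set 'rV[R]_l) :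
  (forall i, i \in s -> small (S i)) ->
  small (fun e => \bigcup_(i in [set` s]) S i e).
Proof.
elim: s => [|i s IHs] h.
  by apply: small_null => e; apply: covered_le covered0 => // x [].
apply: small_sub (smallU (h i (mem_head _ _)) (IHs _)).
  move=> e x [j /=]; rewrite inE => /predU1P[->|js] xj; first by left.
  by right; exists j.
by move=> j js; apply: h; rewrite inE js orbT.
Qed.

End covered.

Section mesh_measure.
Variables (R : realType) (l : nat) (cell : finType) (M : mesh R l cell).
Variables (Omega : set 'rV[R]_l) (alpha : R).
Hypothesis adm : admissible_mesh M Omega alpha.
Implicit Types (K L : cell) (s : set 'rV[R]_l) (x y z v : 'rV[R]_l).
Local Notation mu := (lebesgue_rV R l).

Lemma hitsE e v x s : hits e v x s <-> prism (- v) s `[0, e] x.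
Proof.
split=> [[t te sx]|[y sy [t /= te <-]]].
  exists (x + t *: v) => //; exists t; first by rewrite /= in_itv.
  by rewrite scalerN addrK.
by exists t; [move: te; rewrite in_itv|rewrite scalerN subrK].
Qed.

Lemma normal_neq0 K s : s \in edges M K -> normal M K s != 0.
Proof. by move=> sK; rewrite -dotv_eq0 (normal_unit adm sK) oner_neq0. Qed.

Lemma edge_measurable K s : s \in edges M K -> measurable s.
Proof. by move=> sK; apply: closed_measurable_rV; exact: (edges_closed adm sK). Qed.

Lemma edge_area_ge0 K s : 0 <= edge_area M K s.
Proof. exact: fine_ge0. Qed.

Lemma covered_hits K s e v : s \in edges M K -> 0 <= e ->
  covered [set x | hits e v x s] (e * (`|dotv (normal M K s) v| * edge_area M K s)).
Proof.
move=> sK e0; have [c sc] := edge_flat adm sK.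
have [nv|nv] := eqVneq (dotv (normal M K s) v) 0.
  rewrite nv normr0 mul0r mulr0; apply: covered_le (covered_hplane c (normal_neq0 sK)) => //.
  by move=> x /hitsE; apply: prism_hplane => //; rewrite dotvNr nv oppr0.
have nv' : dotv (normal M K s) (- v) != 0 by rewrite dotvNr oppr_eq0.
exists (prism (- v) s `[0, e]); split.
- by apply: (measurable_prism nv' sc) => //; exact: edge_measurable sK.
- by move=> x /hitsE.
- rewrite (mu_prism true false (normal_unit adm sK) nv' sc)//; first by rewrite dotvNr normrN.
  + exact: (edges_closed adm sK).
  + exact: (edge_bounded adm sK).
Qed.

(** The segment meets [s] at distance at most [e * `|v|] from [s'], so that [x]
    lies in a prism of height [e] whose base shrinks to [s `&` s'], a set of zero
    area. *)
Lemma small_corner_pair K s s' v : s \in edges M K -> s' \in edges M K -> s != s' ->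
  small (fun e => [set x | hits e v x s /\ hits e v x s']).
Proof.
move=> sK s'K ss'; have [c sc] := edge_flat adm sK; set n := normal M K s in sc.
have [nv|nv] := eqVneq (dotv n v) 0.
  apply: small_null => e; apply: covered_le (covered_hplane c (normal_neq0 sK)) => //.
  by move=> x [/hitsE + _]; apply: prism_hplane => //; rewrite dotvNr nv oppr0.
have nv' : dotv n (- v) != 0 by rewrite dotvNr oppr_eq0.
have ms := edge_measurable sK; have bs := edge_bounded adm sK.
have cs : closed s by exact: (edges_closed adm sK).
have cs' : closed s' by exact: (edges_closed adm s'K).
move=> eta eta0.
have [d d0] := vol_prism_fat nv' sc ms bs cs' eta0.
rewrite (vol_prism (normal_unit adm sK) nv' (c := c) (A := s `&` s')); last 3 first.
- by move=> x [/sc].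
- exact: closed_setI.
- by apply: bounded_subset bs => x [].
rewrite (edges_overlap adm sK s'K ss') mulr0 add0r => hd.
have v1 : 0 < `|v| + 1 by rewrite ltr_wpDl.
exists (d / (`|v| + 1)); first by rewrite divr_gt0.
move=> e /andP[e0]; rewrite ltr_pdivlMr// => ed.
have Dc : s `&` fat s' d `<=` hplane n c by move=> x [/sc].
have mD : measurable (s `&` fat s' d) by apply: measurableI => //; exact: measurable_fat.
exists (prism (- v) (s `&` fat s' d) `[0, e]); split.
- exact: (measurable_prism nv' Dc).
- move=> x [[t te sx] [t' te' sx']]; apply/hitsE; exists t => //; split => //.
  apply/fatP; exists (x + t' *: v) => //.
  rewrite opprD addrACA subrr add0r -scalerBl normrZ.
  have tt : `|t' - t| <= e by rewrite ler_norml; lra.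
  apply: le_lt_trans ed; rewrite mulrDr mulr1.
  have : `|t' - t| * `|v| <= e * `|v| by rewrite ler_wpM2r.
  by lra.
- rewrite (mu_prism_itv nv' Dc)//; last 2 first.
  + by apply: bounded_subset bs => x [].
  + exact: ltW.
  by rewrite lee_fin ler_pM2l.
Qed.

Lemma small_corner K v : small (fun e => corner M K e v).
Proof.
pose pairs := [seq p <- [seq (s, s') | s <- edges M K, s' <- edges M K] | p.1 != p.2].
apply: (small_sub (S' := fun e => \bigcup_(p in [set` pairs])
  [set x | hits e v x p.1 /\ hits e v x p.2])).
  move=> e x [s [s' [sK s'K ss' h h']]]; exists (s, s') => //=.
  by rewrite mem_filter ss'/=; apply/allpairsP; exists (s, s').
apply: small_seq => p; rewrite mem_filter => /andP[pp /allpairsP[[s s'] /= [sK s'K pE]]].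
by move: pp; rewrite {}pE /= => pp; exact: (small_corner_pair v sK s'K pp).
Qed.

Lemma small_grazing v : small (fun e => grazing M e v).
Proof.
apply: small_null => e.
pose G (K : cell) s := [set x | exists2 y, s y & dotv (normal M K s) x = dotv (normal M K s) y \/
     dotv (normal M K s) (x + e *: v) = dotv (normal M K s) y].
apply: (covered_le (S' := \bigcup_(K in [set` enum cell]) \bigcup_(s in [set` edges M K]) G K s)
   (r := \sum_(K <- enum cell) \sum_(s <- edges M K) 0)).
- move=> x [K [s [y [sK sy h]]]]; exists K; rewrite /= ?mem_enum//.
  by exists s => //; exists y.
- by rewrite big1// => K _; rewrite big1.
apply: covered_seq => K _; apply: covered_seq => s sK.
have [c sc] := edge_flat adm sK; set n := normal M K s in sc.
rewrite -[0]addr0; apply: covered_le (coveredU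
  (covered_hplane c (normal_neq0 sK)) (covered_hplane (c - e * dotv n v) (normal_neq0 sK))) => //.
move=> x [y /sc yc]; rewrite /hplane/= -/n dotvDr dotvZr yc => -[->|<-]; [by left|right].
by rewrite /= addrK.
Qed.

Definition irregular e v : set 'rV[R]_l :=
  grazing M e v `|` \bigcup_(K in [set` enum cell]) corner M K e v.

Lemma small_irregular v : small (fun e => irregular e v).
Proof.
apply: smallU; first exact: small_grazing.
by apply: small_seq => K _; exact: small_corner.
Qed.

Lemma not_irregular e v x : ~ irregular e v x -> ~ grazing M e v x /\ forall K, ~ corner M K e v x.
Proof.
move=> nb; split => [g|K c]; apply: nb; [by left|right].
by exists K => //=; rewrite mem_enum.
Qed.

Lemma edge_area_sym K L : neighbour M K L ->
  edge_area M K (interface M K L) = edge_area M L (interface M L K).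
Proof.
move=> KL; rewrite [interface M L K]interfaceC; set s := interface M K L.
have sK : s \in edges M K := neighbour_edge KL.
have sL : s \in edges M L := neighbour_edge_sym adm KL.
have [c sc] := edge_flat adm sK; have [c' sc'] := edge_flat adm sL.
apply: (flat_area_indep (normal_unit adm sK) (normal_unit adm sL) sc sc').
- exact: (edges_closed adm sK).
- exact: (edge_bounded adm sK).
Qed.

(** The points of the interface that lie on another edge of [K] or [L] have zero
    area, while the interface does not: some point is smooth for both cells. *)
Lemma normal_antisym K L : neighbour M K L ->
  normal M L (interface M L K) = - normal M K (interface M K L).
Proof.
move=> KL; rewrite [interface M L K]interfaceC; set s := interface M K L.
have sK : s \in edges M K := neighbour_edge KL.
have sL : s \in edges M L := neighbour_edge_sym adm KL.
have KneL : K != L by case/andP: KL; rewrite eq_sym.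
have [c sc] := edge_flat adm sK; have [c' sc'] := edge_flat adm sL.
have cs : closed s by exact: (edges_closed adm sK).
have bs := edge_bounded adm sK.
have n1 := normal_unit adm sK; have n1' := normal_unit adm sL.
have nn : dotv (normal M K s) (normal M K s) != 0 by rewrite n1 oner_neq0.
have [[y [smK smL]]|nosm] := pselect (exists y, smooth_point M K s y /\ smooth_point M L s y).
  exact: (opposite_normals adm KneL sK sL smK smL).
exfalso; have := edges_area_gt0 adm sK.
suff : edge_area M K s <= 0 by move=> /le_lt_trans h /h; rewrite ltxx.
pose others := [seq s' <- edges M K ++ edges M L | s' != s].
rewrite -lee_fin /edge_area (flat_areaE n1 sc)// /vol fineK; last first.
  by apply: (fin_num_prism nn sc) => //; exact: closed_measurable_rV.
apply: covered_mu; first by apply: (measurable_prism nn sc) => //; exact: closed_measurable_rV.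
apply: (covered_le (S' := \bigcup_(s' in [set` others]) prism (normal M K s) (s `&` s') `[0, 1[)
  (r := \sum_(s' <- others) 0)).
- move=> _ [y sy [t t01 <-]].
  have [s' s'o s'y] : exists2 s', s' \in others & s' y.
    apply/not_notP => h; apply: nosm; exists y; split; split => // s' s'K s'y;
    apply/eqP/negPn/negP => s's; apply: h; exists s' => //;
    by rewrite mem_filter s's mem_cat s'K ?orbT.
  by exists s' => //; exists y => //; exists t.
- by rewrite big1.
apply: covered_seq => s'; rewrite mem_filter mem_cat => /andP[s's s'KL].
have ss'c : s `&` s' `<=` hplane (normal M K s) c by move=> x [/sc].
have ss'c' : s `&` s' `<=` hplane (normal M L s) c' by move=> x [/sc'].
have cs' : closed s' by case/orP: s'KL => h; exact: (edges_closed adm h).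
have css' : closed (s `&` s') by exact: closed_setI.
have bss' : bounded_set (s `&` s') by apply: bounded_subset bs => x [].
have mss' := closed_measurable_rV css'.
have area0 : flat_area (normal M K s) (s `&` s') = 0.
  case/orP: s'KL => h; first by apply: (edges_overlap adm sK h); rewrite eq_sym.
  rewrite (flat_area_indep n1 n1' ss'c ss'c')//.
  by apply: (edges_overlap adm sL h); rewrite eq_sym.
exists (prism (normal M K s) (s `&` s') `[0, 1[); split => //.
  exact: (measurable_prism nn ss'c).
by rewrite (mu_prism true true n1 nn ss'c)// area0 !mulr0.
Qed.

End mesh_measure.

(** * Flux out of a union of control volumes *)

Section boundary.
Variables (R : realType) (l : nat).
Local Notation mu := (lebesgue_rV R l).

(** The constant is the total edge area of one admissible mesh, which covers the
    frontier of [Omega]; it serves for all the other meshes. *)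
Lemma frontier_layer (Omega : set 'rV[R]_l) : open Omega -> exists2 B : R, 0 <= B &
  forall (cell : finType) (M : mesh R l cell) (alpha : R), admissible_mesh M Omega alpha ->
  forall e v, 0 <= e ->
    covered [set x | hits e v x (frontier Omega)] (e * (B * enorm v)).
Proof.
move=> oO.
have [[cell [M [alpha adm]]]|no_mesh] := pselect (exists (cell : finType)
  (M : mesh R l cell) (alpha : R), admissible_mesh M Omega alpha); last first.
  by exists 0 => // cell M alpha adm; exfalso; apply: no_mesh; exists cell, M, alpha.
exists (\sum_(K <- enum cell) \sum_(s <- edges M K) edge_area M K s).
  by apply: sumr_ge0 => K _; apply: sumr_ge0 => s _; exact: edge_area_ge0.
move=> _ _ _ _ e v e0.
apply: (covered_le (S' := \bigcup_(K in [set` enum cell]) \bigcup_(s in [set` edges M K])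
    [set x | hits e v x s]) (r := \sum_(K <- enum cell) \sum_(s <- edges M K)
    e * (`|dotv (normal M K s) v| * edge_area M K s))).
- move=> x [t te [clO nO]].
  have : closure Omega (x + t *: v) by [].
  rewrite -(cv_cover adm) => -[K _ clK].
  have /(frontier_cvE adm)[s sK sx] : frontier (cv M K) (x + t *: v).
    split => // /interior_subset /(cv_sub adm) h.
    by apply: nO; rewrite (interior_id _).1.
  by exists K; [rewrite /= mem_enum|exists s => //; exists t].
- rewrite mulr_suml mulr_sumr ler_sum// => K _.
  rewrite mulr_suml mulr_sumr big_seq [leRHS]big_seq ler_sum// => s sK.
  rewrite ler_wpM2l// mulrC ler_wpM2l ?edge_area_ge0// dotv_le_enorm//.
  exact: (normal_unit adm sK).
- by apply: covered_seq => K _; apply: covered_seq => s sK; exact: (covered_hits adm).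
Qed.

Lemma cv_measurable (cell : finType) (M : mesh R l cell) Omega alpha K :
  admissible_mesh M Omega alpha -> measurable (cv M K).
Proof. by move=> adm; apply: open_measurable_rV; exact: (cv_open adm). Qed.

Definition union_cells (cell : finType) (M : mesh R l cell) (A : {set cell}) :=
  \bigcup_(K in [set` enum A]) cv M K.

Section outflow.
Variables (cell : finType) (M : mesh R l cell) (Omega : set 'rV[R]_l) (alpha : R).
Hypothesis adm : admissible_mesh M Omega alpha.
Implicit Types (A : {set cell}) (v : 'rV[R]_l).

Lemma union_cellsP A x : union_cells M A x <-> exists2 K, K \in A & cv M K x.
Proof.
split=> -[K KA Kx]; exists K => //; first by move: KA; rewrite /= mem_enum.
by rewrite /= mem_enum.
Qed.

Lemma union_cells_measurable A : measurable (union_cells M A).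
Proof.
apply: fin_bigcup_measurable; first exact: finite_seq.
by move=> K _; exact: cv_measurable adm.
Qed.

Lemma union_cells_finite A : (mu (union_cells M A) < +oo)%E.
Proof.
apply: bounded_mu_fin; first exact: union_cells_measurable.
rewrite /union_cells; elim: (enum A) => [|K s [m hm]].
  by apply/bounded_setE; exists 0 => x [].
have /bounded_setE[m1 hm1] : bounded_set (\bigcup_(J in [set` s]) cv M J) by exists m.
have /bounded_setE[m2 hm2] := cv_bounded adm K.
apply/bounded_setE; exists (Num.max m1 m2) => x [J /=].
rewrite inE le_max => /predU1P[->|Js] Jx; first by rewrite hm2// orbT.
by rewrite hm1//; exists J.
Qed.

Definition exit_set A w :=
  union_cells M A `&` ~` ((fun x => x + w) @^-1` union_cells M A).

Definition entry_set A w :=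
  ~` union_cells M A `&` ((fun x => x + w) @^-1` union_cells M A).

(** [U] and its translate have the same finite volume, so they exceed
    their intersection by the same amount. *)
Lemma exit_entry A w : mu (exit_set A w) = mu (entry_set A w).
Proof.
rewrite /exit_set /entry_set; set U := union_cells M A; set V := _ @^-1` U.
have mU : measurable U by exact: union_cells_measurable.
have mV : measurable V by exact: measurable_shift_preimage.
have VU : mu V = mu U by exact: lebesgue_rV_shift.
have Ufin : mu U \is a fin_num by rewrite ge0_fin_numE// union_cells_finite.
have UVfin : mu (U `&` V) \is a fin_num.
  rewrite ge0_fin_numE//; apply: le_lt_trans (union_cells_finite A).
  by apply: measureIl.
have hU : mu U = (mu (U `\` V) + mu (U `&` V))%E by exact: measureDI.
have hV : mu V = (mu (V `\` U) + mu (U `&` V))%E by rewrite [U `&` V]setIC; exact: measureDI.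
have : (mu (U `\` V) + mu (U `&` V) = mu (V `\` U) + mu (U `&` V))%E by rewrite -hU -hV VU.
by rewrite !setDE [~` U `&` V]setIC => /(congr1 (fun z => z - mu (U `&` V))%E); rewrite !addeK.
Qed.

Definition exits A v (p : cell * cell) :=
  [&& p.1 \in A, p.2 \notin A, neighbour M p.1 p.2 &
      0 < dotv (normal M p.1 (interface M p.1 p.2)) v].

Definition edge_flux v (p : cell * cell) :=
  edge_area M p.1 (interface M p.1 p.2) *
  dotv (normal M p.1 (interface M p.1 p.2)) v.

(** The prisms swept by the interfaces, once the irregular points are removed,
    are disjoint since a point [x] and its image [x + e *: v] determine the two
    cells. *)
Lemma exit_volume_ge A e v r : 0 < e -> covered (irregular M e v) (e * r) ->
  ((e * (\sum_(p | exits A v p) edge_flux v p - #|exits A v|%:R * r))%:E <=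
  mu (exit_set A (e *: v)))%E.
Proof.
move=> e0 [D [mD irrD Dr]]; set X := (X in mu X).
pose Q p := prism (- v) (interface M p.1 p.2) `]0, e[ `\` D.
have mX : measurable X.
  apply: measurableI; first exact: union_cells_measurable.
  by apply: measurableC; apply: measurable_shift_preimage; exact: union_cells_measurable.
have QKL p x : exits A v p -> Q p x -> cv M p.1 x /\ cv M p.2 (x + e *: v).
  case: p => K L /and4P[/= KA LA KL nv] [[y sy [t /= t0e <-]]] nD.
  have /not_irregular[_ nc] : ~ irregular M e v (y + t *: (- v)) by move=> /irrD.
  have te : 0 < t < e by move: t0e; rewrite in_itv.
  have sx : interface M K L ((y + t *: (- v)) + t *: v) by rewrite scalerN subrK.
  exact: (cross_interface adm KL te sx nv (nc K) (nc L)).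
have QX p : exits A v p -> Q p `<=` X.
  move=> ep x /(QKL _ _ ep)[Kx Lx]; case/and4P: ep => KA LA _ _; split.
    by apply/union_cellsP; exists p.1.
  move=> /union_cellsP[J JA Jx]; have LJ : p.2 != J by apply: contraNneq LA => ->.
  by have : (cv M p.2 `&` cv M J) (x + e *: v) by []; rewrite (cv_disjoint adm LJ).
have flat p : exits A v p -> exists c, [/\ interface M p.1 p.2 `<=`
    hplane (normal M p.1 (interface M p.1 p.2)) c,
    interface M p.1 p.2 \in edges M p.1 &
    dotv (normal M p.1 (interface M p.1 p.2)) (- v) != 0].
  case/and4P => _ _ KL nv; have sK := neighbour_edge KL.
  have [c sc] := edge_flat adm sK; exists c; split => //.
  by rewrite dotvNr oppr_eq0 gt_eqF.
have mP p : exits A v p -> measurable (prism (- v) (interface M p.1 p.2) `]0, e[).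
  move=> /flat[c [sc sK nv]]; apply: (measurable_prism nv sc) => //.
  exact: (edge_measurable adm sK).
have mQ p : exits A v p -> measurable (Q p).
  by move=> ep; apply: measurableD => //; exact: mP.
have Qlb p : exits A v p -> ((e * (edge_flux v p - r))%:E <= mu (Q p))%E.
  move=> ep; have [c [sc sK nv]] := flat p ep.
  have nv0 : 0 < dotv (normal M p.1 (interface M p.1 p.2)) v by case/and4P: ep.
  rewrite mulrBr EFinB leeBlDr//.
  have -> : (e * edge_flux v p)%:E = mu (prism (- v) (interface M p.1 p.2) `]0%R, e[).
    rewrite (mu_prism false true (normal_unit adm sK) nv sc)//; last first.
    - exact: ltW.
    - exact: (edge_bounded adm sK).
    - exact: (edges_closed adm sK).
    by rewrite dotvNr normrN gtr0_norm// [_ * flat_area _ _]mulrC.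
  apply: (@le_trans _ _ (mu (Q p `|` D))).
    apply: le_mu; [exact: mP|by apply: measurableU => //; exact: mQ|].
    by move=> x Px; have [Dx|nDx] := pselect (D x); [right|left].
  by apply: le_trans (measureU2 _ _ _) _ => //; [exact: mQ|exact: leeD2l].
have := @disjoint_sum_le _ _ _ (enum (exits A v)) Q X (enum_uniq _) mX.
move=> /(_ _ _ _)H.
have memE p : p \in enum (exits A v) -> exits A v p by rewrite mem_enum.
apply: le_trans (H _ _ _); last 3 first.
- by move=> p /memE; exact: mQ.
- by move=> p /memE; exact: QX.
- move=> p q /memE ep /memE eq pq; apply/seteqP; split => // x [/(QKL _ _ ep)[K1 L1] /(QKL _ _ eq)[K2 L2]].
  have [E1|N1] := eqVneq p.1 q.1; last first.
    by have : (cv M p.1 `&` cv M q.1) x by []; rewrite (cv_disjoint adm N1).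
  have [E2|N2] := eqVneq p.2 q.2; last first.
    by have : (cv M p.2 `&` cv M q.2) (x + e *: v) by []; rewrite (cv_disjoint adm N2).
  by move: pq; rewrite [p]surjective_pairing [q]surjective_pairing E1 E2 eqxx.
rewrite big_enum/=.
have -> : e * (\sum_(p | exits A v p) edge_flux v p - #|exits A v|%:R * r) =
   \sum_(p | exits A v p) (e * (edge_flux v p - r)).
  rewrite -mulr_sumr sumrB; congr (_ * (_ - _)).
  by rewrite sumr_const mulr_natl.
by rewrite -sumEFin; apply: lee_sum => p; exact: Qlb.
Qed.

Lemma entry_volume_le A e v b r : 0 < e -> covered (irregular M e v) (e * r) ->
  covered [set x | hits e v x (frontier Omega)] (e * b) ->
  (mu (entry_set A (e *: v)) <=
   (e * (\sum_(p | exits (~: A) v p) edge_flux v p + b + r))%:E)%E.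
Proof.
move=> e0 cirr cO; set Y := (X in mu X).
have mY : measurable Y.
  apply: measurableI; first by apply: measurableC; exact: union_cells_measurable.
  by apply: measurable_shift_preimage; exact: union_cells_measurable.
apply: covered_mu => //.
apply: (covered_le (S' := (\bigcup_(p in [set` enum (exits (~: A) v)])
    [set x | hits e v x (interface M p.1 p.2)] `|` [set x | hits e v x (frontier Omega)])
    `|` irregular M e v) (r := \sum_(p <- enum (exits (~: A) v)) (e * edge_flux v p) + e * b + e * r)).
- move=> x [nUx /union_cellsP[K KA Kx]].
  have [bx|nbx] := pselect (irregular M e v x); first by right.
  have [ng nc] := not_irregular nbx; left.
  have [hO|nO] := pselect (hits e v x (frontier Omega)); [by right|left].
  have xA J : J \in A -> ~ cv M J x by move=> JA Jx; apply: nUx; apply/union_cellsP; exists J.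
  have [L [LA KL nv hx]] := enter_union adm e0 KA xA Kx nO ng nc.
  exists (L, K) => //=; rewrite mem_enum; apply/and4P; split => //=.
  + by rewrite inE.
  + by rewrite inE KA.
  + exact: (neighbour_sym adm).
- by rewrite big_enum/= -mulr_sumr -!mulrDr.
apply: coveredU => //; apply: coveredU => //; apply: covered_seq => p.
rewrite mem_enum => /and4P[_ _ KL nv].
apply: covered_le (covered_hits adm v (neighbour_edge KL) (ltW e0)) => //.
by rewrite gtr0_norm// [_ * edge_area _ _ _]mulrC.
Qed.

End outflow.

(** The divergence theorem for the constant field [v], as an inequality. The
    interfaces entering [A] along [v] are those leaving [A] against [v], so the
    volume balance of [exit_entry] has exactly the sum over all the interfaces
    leaving [A] on one side, and the frontier layer on the other. *)
Lemma flux_through_union (Omega : set 'rV[R]_l) : open Omega -> exists2 B : R, 0 <= B &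
  forall (cell : finType) (M : mesh R l cell) (alpha : R), admissible_mesh M Omega alpha ->
  forall (A : {set cell}) (v : 'rV[R]_l),
  \sum_(K in A) \sum_(L | neighbour M K L && (L \notin A))
    edge_area M K (interface M K L) * dotv (normal M K (interface M K L)) v
  <= B * enorm v.
Proof.
move=> oO; have [B B0 hB] := frontier_layer oO; exists B => //.
move=> cell M alpha adm A v.
have -> : \sum_(K in A) \sum_(L | neighbour M K L && (L \notin A))
    edge_area M K (interface M K L) * dotv (normal M K (interface M K L)) v =
   \sum_(p | exits M A v p) edge_flux M v p - \sum_(p | exits M (~: A) v p) edge_flux M v p.
  have -> : \sum_(p | exits M (~: A) v p) edge_flux M v p =
      \sum_(p | [&& p.1 \in A, p.2 \notin A, neighbour M p.1 p.2 &
      dotv (normal M p.1 (interface M p.1 p.2)) v < 0]) - edge_flux M v p.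
    rewrite (reindex_inj (h := fun p : cell * cell => (p.2, p.1))); last first.
      by move=> [? ?] [? ?] [-> ->].
    have sw K L : neighbour M L K = neighbour M K L.
      by apply/idP/idP; exact: (neighbour_sym adm).
    rewrite (eq_bigl (fun p => [&& p.1 \in A, p.2 \notin A, neighbour M p.1 p.2 &
      dotv (normal M p.1 (interface M p.1 p.2)) v < 0])) => [|[K L]]; last first.
      rewrite /exits /= !inE negbK (sw K L) [RHS]andbCA.
      congr (_ && _); congr (_ && _); apply: andb_id2l => KL.
      by rewrite (normal_antisym adm KL) dotvNl oppr_gt0.
    apply: eq_bigr => -[K L] /and4P[/= _ _ KL _].
    by rewrite /edge_flux/= -(edge_area_sym adm KL) (normal_antisym adm KL) dotvNl mulrN.
  rewrite sumrN opprK pair_big_dep/=.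
  rewrite (bigID (fun p : cell * cell => 0 < dotv (normal M p.1 (interface M p.1 p.2)) v))/=.
  congr (_ + _).
    apply: eq_bigl => p; rewrite /exits.
    by case: (p.1 \in A); case: (p.2 \in A); case: (neighbour M p.1 p.2).
  rewrite (bigID (fun p : cell * cell => dotv (normal M p.1 (interface M p.1 p.2)) v < 0))/=.
  rewrite [X in _ + X]big1 ?addr0; last first.
    move=> p /andP[/andP[_]]; rewrite -!leNgt => h1 h2.
    by rewrite [dotv _ _](@le_anti _ _ _ 0) ?mulr0// h1.
  apply: eq_bigl => p; case: (p.1 \in A); case: (p.2 \in A) => //=;
    case: (neighbour M p.1 p.2) => //=; rewrite -leNgt.
  by case: ltP => h; rewrite ?andbF// ltW.
rewrite lerBlDl; apply/ler_addgt0Pr => eta eta0.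
(* one error term o(e) for each prism of the exit set, one for the entry set *)
pose k := #|exits M A v|%:R + 1 : R.
have k0 : 0 < k by rewrite ltr_wpDl.
have [e1 e10 small_] := small_irregular adm v (divr_gt0 eta0 k0).
have e20 : 0 < e1 / 2 by rewrite divr_gt0.
have e2 : 0 < e1 / 2 < e1 by rewrite e20 ltr_pdivrMr// ltr_pMr// ltr1n.
have h1 := exit_volume_ge adm A e20 (small_ _ e2).
have h2 := entry_volume_le adm A e20 (small_ _ e2) (hB _ _ _ adm _ v (ltW e20)).
rewrite (exit_entry adm) in h1; have := le_trans h1 h2.
rewrite lee_fin ler_pM2l//.
have : k * (eta / k) = eta by rewrite mulrC divfK// gt_eqF.
rewrite {1}/k mulrDl mul1r.
lra.
Qed.

End boundary.

(** * Summation by parts *)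

Section summation.
Variable R : realType.

(** Between two consecutive values of [u], the increment of [phi] multiplies the sum of
    [c] over the superlevel set of the upper one. The induction is on the number
    of indices above the level [w]. *)
Lemma abel_lower (I : finType) (c u : I -> R) (phi : R -> R) (um b : R) :
  0 <= um -> 0 <= b -> (forall i, 0 <= u i <= um) ->
  {in `[0, um] &, {homo phi : x y / x <= y}} ->
  (forall w, 0 <= w <= um -> - b <= \sum_(i | w <= u i) c i) ->
  - (b * (phi um - phi 0)) <= \sum_i c i * (phi (u i) - phi 0).
Proof.
move=> um0 b0 uI phi_le hc.
have claim (k : nat) (w : R) : 0 <= w <= um -> (#|[pred i | (w < u i)%R]| < k)%N ->
    - (b * (phi um - phi w)) <= \sum_(i | w < u i) c i * (phi (u i) - phi w).
  elim: k w => // k IHk w wI; rewrite ltnS => wk.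
  have phiw : phi w <= phi um.
    by apply: phi_le; rewrite ?in_itv/= ?um0 ?lexx//; case/andP: wI.
  have [i0 wi0|nopred] := pickP [pred i | (w < u i)%R]; last first.
    by rewrite big_pred0// oppr_le0 mulr_ge0// subr_ge0.
  case: (arg_minP u wi0) => j /= wj jmin; set w' := u j in wj jmin.
  have wI' : 0 <= w' <= um := uI j.
  have predE i : (w < u i) = (w' <= u i).
    by apply/idP/idP => [/jmin//|]; exact: lt_le_trans wj.
  have lt_k : (#|[pred i | (w' < u i)%R]| < k)%N.
    apply: leq_trans wk; apply: proper_card; apply/properP; split.
      by apply/fintype.subsetP => i; rewrite !inE predE; exact: ltW.
    by exists j; rewrite !inE ?ltxx.
  have ww' : phi w <= phi w' by apply: phi_le; rewrite ?in_itv//= ltW.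
  rewrite (eq_bigl _ _ predE) (eq_bigr (fun i => (phi w' - phi w) * c i + c i * (phi (u i) - phi w'))); last first.
    by move=> i _; ring.
  rewrite big_split/= -mulr_sumr.
  have -> : \sum_(i | w' <= u i) c i * (phi (u i) - phi w') =
      \sum_(i | w' < u i) c i * (phi (u i) - phi w').
    rewrite (bigID (fun i => w' < u i))/= [X in _ + X]big1 ?addr0.
      apply: eq_bigl => i; have [h|h] := ltP w' (u i); last by rewrite andbF.
      by rewrite (ltW h).
    move=> i /andP[h1]; rewrite -leNgt => h2.
    by rewrite (@le_anti _ _ (u i) w') ?h1 ?h2// subrr mulr0.
  have := IHk _ wI' lt_k.
  have : (phi w' - phi w) * (- b) <= (phi w' - phi w) * (\sum_(i | w' <= u i) c i).
    by rewrite ler_wpM2l ?subr_ge0// hc.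
  by lra.
rewrite (bigID (fun i => 0 < u i))/= [leRHS]addrC big1 ?add0r.
  by apply: (claim #|I|.+1) => //; [rewrite lexx|rewrite ltnS max_card].
move=> i; rewrite -leNgt => ui0.
by rewrite (@le_anti _ _ (u i) 0) ?subrr ?mulr0// ui0; case/andP: (uI i).
Qed.

(** A discrete chain rule for a primitive of [phi]. For the level [w], the jumps that
    land above [w] dominate the increments of [Num.max (a n) w]. *)
Lemma telescope_lower (a : nat -> R) (phi : R -> R) (um : R) (N : nat) :
  0 <= um -> (forall n, 0 <= a n <= um) ->
  {in `[0, um] &, {homo phi : x y / x <= y}} -> phi 0 = 0 ->
  - (um * phi um) <= \sum_(0 <= n < N) (a n.+1 - a n) * phi (a n.+1).
Proof.
move=> um0 aI phi_le phi0; rewrite big_mkord.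
have := @abel_lower 'I_N (fun n => a n.+1 - a n) (fun n => a n.+1) phi um um.
rewrite phi0 subr0 => /(_ um0 um0 (fun n => aI n.+1) phi_le) h.
under eq_bigr do rewrite -[phi _]subr0.
apply: h => w /andP[w0 wum].
rewrite (big_mkcond (fun i : 'I_N => w <= a i.+1))/=.
pose b n := Num.max (a n) w.
apply: (@le_trans _ _ (\sum_(0 <= n < N) (b n.+1 - b n))).
  rewrite telescope_sumr// /b.
  have : w <= Num.max (a N) w by rewrite le_max lexx orbT.
  have : Num.max (a 0%N) w <= um by rewrite ge_max wum andbT; case/andP: (aI 0%N).
  by lra.
rewrite big_mkord ler_sum// => i _; rewrite /b.
have h1 : a i <= Num.max (a i) w by rewrite le_max lexx.
have h2 : w <= Num.max (a i) w by rewrite le_max lexx orbT.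
by case: (leP w (a i.+1)) => h3; lra.
Qed.

End summation.

(** * Energy estimate *)

Section energy.
Variables (R : realType) (l : nat).

Lemma enormN (v : 'rV[R]_l) : enorm (- v) = enorm v.
Proof. by rewrite /enorm dotvNl dotvNr opprK. Qed.

Lemma continuous_enorm : continuous (@enorm R l).
Proof.
have cd : continuous (fun x : 'rV[R]_l => dotv x x).
  apply: continuous_big => [|i _]; first exact: add_continuous.
  move=> x; have ci : (fun y : 'rV[R]_l => y 0 i) @ x --> x 0 i.
    exact: (@coord_continuous _ 1 l 0 i x).
  exact: (cvgM ci ci).
by move=> x; apply: continuous_comp; [exact: cd|exact: sqrt_continuous].
Qed.

Lemma enorm_le_sup_norm umax (f : R -> 'rV[R]_l) s : convection umax f ->
  0 <= s <= umax -> enorm (f s) <= sup_norm umax f.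
Proof.
move=> [cf _ _] sI; rewrite /sup_norm; apply: ub_le_sup; last by exists s => //=; rewrite in_itv.
have um0 : 0 <= umax by lra.
have cef : {within `[0, umax], continuous (@enorm R l \o f)}.
  by apply: within_continuous_comp cf => x _; exact: continuous_enorm.
have [m _ hm] := EVT_max um0 cef.
by exists (enorm (f m)) => _ [t /= tI <-]; exact: hm.
Qed.

Section sums.
Variables (cell : finType) (M : mesh R l cell) (Omega : set 'rV[R]_l) (alpha : R).
Hypothesis adm : admissible_mesh M Omega alpha.

Lemma neighbourC K L : neighbour M K L = neighbour M L K.
Proof. by apply/idP/idP; exact: (neighbour_sym adm). Qed.

Lemma swap_neighbours (A : {pred cell}) (G : cell -> cell -> R) :
  \sum_(K | A K) \sum_(L | neighbour M K L && A L) G K L =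
  \sum_(K | A K) \sum_(L | neighbour M K L && A L) G L K.
Proof.
rewrite (exchange_big_dep A)/=; last by move=> K L _ /andP[].
apply: eq_bigr => L AL; apply: eq_bigl => K.
by rewrite neighbourC AL andbT andbC.
Qed.

Lemma transmissivityC K L : neighbour M K L -> transmissivity M K L = transmissivity M L K.
Proof.
move=> KL; rewrite /transmissivity (edge_area_sym adm KL); congr (_ / _).
by rewrite /center_dist -enormN opprB.
Qed.

Lemma dissipationE (p : cell -> R) :
  - \sum_K p K * \sum_(L | neighbour M K L) transmissivity M K L * (p L - p K) =
  2^-1 * \sum_K \sum_(L | neighbour M K L) transmissivity M K L * `|p K - p L| ^+ 2.
Proof.
pose G K L := transmissivity M K L * (p K - p L) * p K.
have E : - \sum_K p K * \sum_(L | neighbour M K L) transmissivity M K L * (p L - p K) =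
    \sum_K \sum_(L | neighbour M K L) G K L.
  rewrite -sumrN; apply: eq_bigr => K _; rewrite mulr_sumr -sumrN.
  by apply: eq_bigr => L _; rewrite /G; ring.
have E' : \sum_K \sum_(L | neighbour M K L) G K L = \sum_K \sum_(L | neighbour M K L) G L K.
  have := swap_neighbours predT G.
  by under eq_bigr do under eq_bigl do rewrite andbT; under [RHS]eq_bigr do under eq_bigl do rewrite andbT.
have H : \sum_K \sum_(L | neighbour M K L) transmissivity M K L * `|p K - p L| ^+ 2 =
   \sum_K \sum_(L | neighbour M K L) G K L + \sum_K \sum_(L | neighbour M K L) G L K.
  rewrite -big_split/=; apply: eq_bigr => K _; rewrite -big_split/=; apply: eq_bigr => L KL.
  by rewrite real_normK ?num_real// /G -(transmissivityC KL); ring.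
by rewrite E H -E'; lra.
Qed.

Lemma total_volume : open Omega -> bounded_set Omega ->
  \sum_(K : cell) vol (cv M K) <= vol Omega.
Proof.
move=> oO bO; have mO := open_measurable_rV oO.
rewrite -lee_fin [X in (_ <= X)%E]fineK ?ge0_fin_numE ?bounded_mu_fin// -sumEFin.
have h : (\sum_(K <- enum cell) lebesgue_rV R l (cv M K) <= lebesgue_rV R l Omega)%E.
  apply: disjoint_sum_le => //; first exact: enum_uniq.
  - by move=> K _; exact: cv_measurable adm.
  - by move=> K _; exact: (cv_sub adm).
  - by move=> K L _ _; exact: (cv_disjoint adm).
apply: le_trans h; rewrite big_enum/=; apply: lee_sum => K _.
rewrite fineK// ge0_fin_numE// bounded_mu_fin//; first exact: cv_measurable adm.
exact: (cv_bounded adm).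
Qed.

(** If [w] lies between [u L] and [u K], monotonicity gives
    [F K s w w <= F K s (u K) (u L)], and consistency turns the left-hand side into
    the flux of the constant field [f w], to which [hB] applies. *)
Lemma convection_lower (B umax lip : R) (f : R -> 'rV[R]_l) (F : fluxes R l cell)
    (phi : R -> R) (u : cell -> R) :
  0 <= umax -> 0 <= B ->
  (forall (A : {set cell}) (v : 'rV[R]_l),
    \sum_(K in A) \sum_(L | neighbour M K L && (L \notin A))
      edge_area M K (interface M K L) * dotv (normal M K (interface M K L)) v
    <= B * enorm v) ->
  convection umax f -> numerical_flux M umax f lip F ->
  {in `[0, umax] &, {homo phi : a b / a <= b}} -> phi 0 = 0 ->
  (forall K, 0 <= u K <= umax) ->
  - (B * sup_norm umax f * phi umax) <=
  \sum_K phi (u K) * \sum_(L | neighbour M K L) F K (interface M K L) (u K) (u L).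
Proof.
move=> um0 B0 hB cf nf phi_le phi0 uI.
pose c K := \sum_(L | neighbour M K L) F K (interface M K L) (u K) (u L).
have sn0 : 0 <= sup_norm umax f.
  by apply: le_trans (enorm_le_sup_norm cf (_ : 0 <= 0 <= umax)); rewrite ?sqrtr_ge0// lexx.
have := @abel_lower _ cell c u phi umax (B * sup_norm umax f) um0 (mulr_ge0 B0 sn0) uI phi_le.
rewrite phi0 subr0 => h.
under eq_bigr do rewrite mulrC -[phi _]subr0.
apply: h => w wI; pose A : {set cell} := finset (fun K => w <= u K).
have -> : \sum_(K | w <= u K) c K = \sum_(K in A) c K by apply: eq_bigl => K; rewrite inE.
have inI x : 0 <= x <= umax -> x \in `[0, umax] by rewrite in_itv.
have E : \sum_(K in A) c K = \sum_(K in A) \sum_(L | neighbour M K L && (L \in A))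
    F K (interface M K L) (u K) (u L) +
    \sum_(K in A) \sum_(L | neighbour M K L && (L \notin A)) F K (interface M K L) (u K) (u L).
  by rewrite -big_split/=; apply: eq_bigr => K _; rewrite [LHS](bigID (mem A)).
have inner0 : \sum_(K in A) \sum_(L | neighbour M K L && (L \in A))
    F K (interface M K L) (u K) (u L) = 0.
  set S := LHS; suff : S = - S by lra.
  rewrite {1}/S (swap_neighbours (mem A) (fun K L => F K (interface M K L) (u K) (u L))).
  rewrite -sumrN; apply: eq_bigr => K _; rewrite -sumrN; apply: eq_bigr => L /andP[KL _].
  by rewrite (flux_conservative nf (neighbour_sym adm KL))// inI.
rewrite E inner0 add0r.
have := hB A (- f w); rewrite enormN => hA.
apply: (@le_trans _ _ (\sum_(K in A) \sum_(L | neighbour M K L && (L \notin A))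
    - (edge_area M K (interface M K L) * dotv (normal M K (interface M K L)) (- f w)))).
  under eq_bigr do rewrite sumrN.
  rewrite sumrN lerN2; apply: le_trans hA _; rewrite ler_wpM2l//.
  exact: enorm_le_sup_norm.
apply: ler_sum => K; rewrite inE => wK; apply: ler_sum => L /andP[KL].
rewrite inE -ltNge => Lw; have sK := neighbour_edge KL.
have wm := inI _ wI; have Km := inI _ (uI K); have Lm := inI _ (uI L).
rewrite dotvNr mulrN opprK dotvC -(flux_consistent nf sK)//.
apply: (@le_trans _ _ (F K (interface M K L) w (u L))).
  by apply: (flux_monotone_r nf sK) => //; exact: ltW.
exact: (flux_monotone_l nf sK).
Qed.

End sums.
End energy.

Section energy_balance.
Variables (R : realType) (l : nat) (cell : finType) (M : mesh R l cell).
Variables (Omega : set 'rV[R]_l) (alpha : R).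
Hypothesis adm : admissible_mesh M Omega alpha.

(** The scheme tested with [phi (u n.+1 K)]. *)
Lemma energy_step (umax dt : R) (phi : R -> R) (u0 : 'rV[R]_l -> R)
    (F : fluxes R l cell) (u : nat -> cell -> R) (n : nat) :
  0 < dt -> scheme_solution M umax dt phi u0 F u ->
  2^-1 * (dt * \sum_K \sum_(L | neighbour M K L)
     transmissivity M K L * `|phi (u n.+1 K) - phi (u n.+1 L)| ^+ 2) =
  - (\sum_K vol (cv M K) * ((u n.+1 K - u n K) * phi (u n.+1 K)))
  - dt * \sum_K phi (u n.+1 K) *
      \sum_(L | neighbour M K L) F K (interface M K L) (u n.+1 K) (u n.+1 L).
Proof.
move=> dt0 sol; rewrite mulrCA -(dissipationE adm (fun K => phi (u n.+1 K))).
rewrite [in RHS]mulr_sumr -!sumrN -big_split/= mulr_sumr; apply: eq_bigr => K _.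
set S := \sum_(L | _) transmissivity _ _ _ * _.
set G := \sum_(L | _) F _ _ _ _.
have /eqP := scheme_step sol n K; rewrite -/S -/G subr_eq0 => /eqP <-.
set q := (_ / dt); have -> : u n.+1 K - u n K = dt * q.
  by rewrite /q mulrCA divff ?mulr1// gt_eqF.
ring.
Qed.

End energy_balance.

Theorem lemma4p4 (R : realType) (l : nat) (Omega : set 'rV[R]_l) (phi : R -> R)
    (l_ge1 : (1 <= l)%N)
    (Omega_open : open Omega)
    (Omega_bounded : bounded_set Omega)
    (Omega_lipschitz : lipschitz_boundary Omega) :
  exists C : R -> R -> R -> R,
    (forall a b c, 0 <= C a b c) /\
    forall (umax uc : R) (f : R -> 'rV[R]_l) (u0 : 'rV[R]_l -> R)
           (cell : finType) (M : mesh R l cell) (alpha lip : R)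
           (F : fluxes R l cell) (dt T : R) (u : nat -> cell -> R) (N : nat),
      0 < umax ->
      convection umax f ->
      diffusion umax uc phi ->
      non_degenerate uc f ->
      measurable_fun Omega u0 ->
      (forall x, Omega x -> 0 <= u0 x <= umax) ->
      0 < alpha ->
      admissible_mesh M Omega alpha ->
      #|cell|%:R <= vol Omega / alpha * mesh_size M ^- l ->
      numerical_flux M umax f lip F ->
      0 < dt ->
      scheme_solution M umax dt phi u0 F u ->
      0 < T ->
      dt <= T ->
      N%:R < T / dt ->
      (forall n : nat, n%:R < T / dt -> (n <= N)%N) ->
      2^-1 * \sum_(0 <= n < N.+1) dt *
        (\sum_(K : cell) \sum_(L | neighbour M K L)
           transmissivity M K L * `|phi (u n.+1 K) - phi (u n.+1 L)| ^+ 2)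
      <= C (sup_norm umax f) umax T.
Proof.
have [B B0 hB] := flux_through_union Omega_open.
exists (fun a b c => vol Omega * (`|b| * `|phi b|) + 2 * `|c| * (B * `|a| * `|phi b|)).
split.
  by move=> a b c; rewrite addr_ge0 ?mulr_ge0// /vol fine_ge0.
move=> umax uc f u0 cell M alpha lip F dt T u N um0 cf dphi _ _ _ _ adm _ nf dt0 sol T0 dtT NT _.
have phi_le := diffusion_nondecreasing dphi.
have um0' := ltW um0.
have phi0 : phi 0 = 0.
  by apply: (diffusion_zero dphi); rewrite in_itv/= lexx; case/andP: (diffusion_uc dphi).
have phium : 0 <= phi umax.
  by rewrite -{1}phi0; apply: phi_le; rewrite ?in_itv/= ?um0' ?lexx.
have sn0 : 0 <= sup_norm umax f.
  by apply: le_trans (enorm_le_sup_norm cf (_ : 0 <= 0 <= umax)); rewrite ?sqrtr_ge0// lexx.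
rewrite !ger0_norm ?(ltW T0)// mulr_sumr.
under eq_bigr do rewrite (energy_step adm _ dt0 sol).
rewrite big_split/= !sumrN; apply: lerD.
- rewrite exchange_big/= -sumrN.
  apply: (@le_trans _ _ (\sum_K vol (cv M K) * (umax * phi umax))); last first.
    by rewrite -mulr_suml ler_wpM2r ?mulr_ge0// (total_volume adm).
  apply: ler_sum => K _; rewrite -mulr_sumr -mulrN ler_wpM2l ?fine_ge0// lerNl.
  exact: (telescope_lower (a := fun n => u n K) N.+1 um0' (fun n => scheme_range sol n K)).
- pose b := B * sup_norm umax f * phi umax.
  apply: (@le_trans _ _ (\sum_(0 <= n < N.+1) dt * b)).
    rewrite -sumrN; apply: ler_sum => n _; rewrite -mulrN ler_wpM2l ?(ltW dt0)// lerNl.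
    exact: (convection_lower adm um0' B0 (hB _ _ _ adm) cf nf phi_le phi0 (fun K => scheme_range sol n.+1 K)).
  rewrite sumr_const_nat subn0 -[leLHS]mulr_natl [leLHS]mulrA -/b ler_wpM2r ?mulr_ge0//.
  rewrite -natr1 mulrDl mul1r.
  by move: NT; rewrite ltr_pdivlMr//; lra.
Qed.
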